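(* Let $(X,G)$ be a minimal topological dynamical system satisfying the local Bronstein condition, where $G$ is amenable. Then every $E\in\mathcal X_{eq}^{\mathrm{meas}}$ is a weakly mean-sensitive set.
   Context: $G$ is an infinite countable discrete group; a tds $(X,G)$ is a compact metric space $(X,d)$ with a $G$-action by homeomorphisms; minimal means no proper nonempty closed invariant subset; a minimal point has minimal orbit closure. $\pi_{eq}:X\to X_{eq}$ is the factor map onto the maximal equicontinuous factor, $\nu_{eq}$ the unique invariant probability measure of $(X_{eq},G)$. $RP_2(X,G)$ is the set of $(x_1,x_2)$ such that for every $\epsilon>0$ there are $x_1',x_2'$ and $g$ with $d(x_k,x_k')\le\epsilon$, $d(gx_1',gx_2')\le\epsilon$; local Bronstein means whenever $(x,x')\in RP_2(X,G)$ is a minimal point of $(X\times X,G)$, there are minimal points $(x_n,x_n')\to(x,x')$ of $(X\times X,G)$ and $g_n\in G$ with $d(g_nx_n,g_nx_n')\to0$. $2^X$ is the space of nonempty closed subsets with the Hausdorff metric $d_H$. $\mathcal X=\overline{\{\pi_{eq}^{-1}(y):y\in X_{eq}\}}\subset 2^X$; for $E\in\mathcal X$, $\pi_{\mathcal X}(E)$ is the single point $\pi_{eq}(E)$. $\mathcal X_{eq}^{\mathrm{meas}}=\{E\in\mathcal X: \nu_{eq}(\pi_{\mathcal X}(B^{\mathcal X}_\epsilon(E)))>0\ \forall\epsilon>0\}$, $B^{\mathcal X}_\epsilon(E)$ the open $d_H$-ball in $\mathcal X$. $\overline{BD}(F)=\max_{\{F_n\}}\limsup_n|F_n\cap F|/|F_n|$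 over Følner sequences. $(x_1,\dots,x_K)$ is a weakly mean-sensitive tuple if for all open neighborhoods $U_k\ni x_k$ there is $\delta>0$ such that for every nonempty open $U\subset X$, $\overline{BD}(\{g: gU\cap U_k\neq\emptyset\ \forall k\})>\delta$; a weakly mean-sensitive set is one all of whose finite tuples are weakly mean-sensitive. *)

(* Defs.v *)
From HB Require Import structures.
From mathcomp Require Import all_boot all_order all_algebra.
From mathcomp Require Import finmap.
From mathcomp Require Import all_classical all_reals all_analysis.
Set Implicit Arguments. Unset Strict Implicit. Unset Printing Implicit Defensive.
Import Order.TTheory GRing.Theory Num.Theory.
Local Open Scope classical_set_scope.
Local Open Scope ring_scope.

Record grp (G : Type) := Grp {
  gmul : G -> G -> G;
  gone : G;
  ginv : G -> G;
  gmulA : forall a b c, gmul a (gmul b c) = gmul (gmul a b) c;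
  gmul1 : forall a, gmul gone a = a;
  gmulV : forall a, gmul (ginv a) a = gone }.

Section Metric.
Variable R : realType.
Variable T : Type.
Variable d : T -> T -> R.

Definition is_metric : Prop :=
  [/\ forall x y, 0 <= d x y,
      forall x y, d x y = 0 <-> x = y,
      forall x y, d x y = d y x &
      forall x y z, d x z <= d x y + d y z].

Definition mopen (A : set T) : Prop :=
  forall x, A x -> exists2 r : R, 0 < r & forall y, d x y < r -> A y.

Definition mclosed (A : set T) : Prop := mopen (~` A).

Definition mcompact : Prop :=
  forall (I : Type) (U : I -> set T), (forall i, mopen (U i)) ->
    setT `<=` \bigcup_(i in setT) U i ->
    exists2 F : set I, finite_set F & setT `<=` \bigcup_(i in F) U i.

Definition borel_sets : set (set T) := <<s [set A | mopen A] >>.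

Definition hausdorff_dist (A B : set T) : R :=
  Num.max (sup [set inf [set d a b | b in B] | a in A])
          (sup [set inf [set d a b | a in A] | b in B]).

Definition hyperspace : set (set T) := [set A | A !=set0 /\ mclosed A].

End Metric.

Definition mcontinuous (R : realType) (T U : Type) (dT : T -> T -> R)
  (dU : U -> U -> R) (f : T -> U) : Prop :=
  forall x (e : R), 0 < e -> exists2 r : R, 0 < r &
    forall y, dT x y < r -> dU (f x) (f y) < e.

Definition dprod (R : realType) (T : Type) (d : T -> T -> R) (p q : T * T) : R :=
  Num.max (d p.1 q.1) (d p.2 q.2).

Section Dynamics.
Variable R : realType.
Variables (G : Type) (gG : grp G).
Variables (T : Type) (d : T -> T -> R) (act : G -> T -> T).

(* (T, G) is a topological dynamical system: compact metric space with an
   action by homeomorphisms (continuity of each act g + group action laws) *)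
Definition tds : Prop :=
  [/\ is_metric d, mcompact d,
      forall x, act (gone gG) x = x,
      forall g h x, act (gmul gG g h) x = act g (act h x) &
      forall g, mcontinuous d d (act g)].

Definition invariant (A : set T) : Prop := forall g x, A x -> A (act g x).

Definition minimal_set (Y : set T) : Prop :=
  forall Z, Z `<=` Y -> Z !=set0 -> mclosed d Z -> invariant Z -> Z = Y.

Definition minimal : Prop := minimal_set setT.

Definition orbit_closure (x : T) : set T :=
  [set y | forall e : R, 0 < e -> exists g, d (act g x) y < e].

Definition minimal_point (x : T) : Prop := minimal_set (orbit_closure x).

Definition equicontinuous : Prop :=
  forall e : R, 0 < e -> exists2 r : R, 0 < r &
    forall x y, d x y < r -> forall g, d (act g x) (act g y) < e.

End Dynamics.

Definition prod_act (G T : Type) (act : G -> T -> T) (g : G) (p : T * T) : T * T :=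
  (act g p.1, act g p.2).

Definition factor_map (R : realType) (G : Type) (T U : Type)
  (dT : T -> T -> R) (actT : G -> T -> T) (dU : U -> U -> R) (actU : G -> U -> U)
  (f : T -> U) : Prop :=
  [/\ mcontinuous dT dU f, (forall y, exists x, f x = y) &
      forall g x, f (actT g x) = actU g (f x)].

Definition max_equicontinuous_factor (R : realType) (G : Type) (gG : grp G)
  (X Y : Type) (dX : X -> X -> R) (actX : G -> X -> X)
  (dY : Y -> Y -> R) (actY : G -> Y -> Y) (pi : X -> Y) : Prop :=
  [/\ tds gG dY actY, equicontinuous dY actY, factor_map dX actX dY actY pi &
      forall (Z : Type) (dZ : Z -> Z -> R) (actZ : G -> Z -> Z) (psi : X -> Z),
        tds gG dZ actZ -> equicontinuous dZ actZ -> factor_map dX actX dZ actZ psi ->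
        exists2 phi : Y -> Z, factor_map dY actY dZ actZ phi &
          forall x, psi x = phi (pi x)].

Definition RP2 (R : realType) (G X : Type) (d : X -> X -> R) (act : G -> X -> X)
  (x1 x2 : X) : Prop :=
  forall e : R, 0 < e -> exists x1' x2' g,
    [/\ d x1 x1' <= e, d x2 x2' <= e & d (act g x1') (act g x2') <= e].

Definition local_Bronstein (R : realType) (G X : Type) (d : X -> X -> R)
  (act : G -> X -> X) : Prop :=
  forall x x' : X, RP2 d act x x' -> minimal_point (dprod d) (prod_act act) (x, x') ->
    exists (u : nat -> X * X) (g : nat -> G),
      [/\ forall n, minimal_point (dprod d) (prod_act act) (u n),
          ((fun n => d (u n).1 x) : R^nat) @ \oo --> 0,
          ((fun n => d (u n).2 x') : R^nat) @ \oo --> 0 &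
          ((fun n => d (act (g n) (u n).1) (act (g n) (u n).2)) : R^nat) @ \oo --> 0].

Local Open Scope fset_scope.

Definition ltranslate (G : choiceType) (gG : grp G) (g : G) (F : {fset G}) : {fset G} :=
  [fset gmul gG g x | x in F].

Definition folner_ratio (R : realType) (G : choiceType) (gG : grp G)
  (g : G) (F : {fset G}) : R :=
  let gF := ltranslate gG g F in
  (#|` fsetU (fsetD gF F) (fsetD F gF)|%:R / #|` F|%:R).

Definition folner (R : realType) (G : choiceType) (gG : grp G) (F : nat -> {fset G}) : Prop :=
  (forall n, F n != fset0) /\
  (forall g, ((fun n => folner_ratio R gG g (F n)) : R^nat) @ \oo --> 0).

(* a countable discrete group is amenable iff it admits a Folner sequence *)
Definition amenable (R : realType) (G : choiceType) (gG : grp G) : Prop :=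
  exists F, folner R gG F.

Local Close Scope fset_scope.

Definition density_along (R : realType) (G : choiceType) (F : nat -> {fset G})
  (S : set G) (n : nat) : R :=
  (#|` fset_set ([set` F n] `&` S)|%:R / #|` F n|%:R).

Definition upper_banach_density (R : realType) (G : choiceType) (gG : grp G)
  (S : set G) : R :=
  sup [set limn_sup (density_along R F S) | F in [set F | folner R gG F]].

Definition wms_tuple (R : realType) (G : choiceType) (gG : grp G) (X : Type)
  (d : X -> X -> R) (act : G -> X -> X) (K : nat) (x : 'I_K -> X) : Prop :=
  forall U : 'I_K -> set X, (forall k, mopen d (U k) /\ U k (x k)) ->
    exists2 delta : R, 0 < delta &
      forall V : set X, mopen d V -> V !=set0 ->
        delta < upper_banach_density R gG
                  [set g | forall k, (act g @` V) `&` U k !=set0].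

Definition wms_set (R : realType) (G : choiceType) (gG : grp G) (X : Type)
  (d : X -> X -> R) (act : G -> X -> X) (E : set X) : Prop :=
  forall (K : nat) (x : 'I_K -> X), (forall k, E (x k)) -> wms_tuple gG d act x.

Section Hyper.
Variable R : realType.
Variables (X Y : Type) (d : X -> X -> R) (pi : X -> Y).

Definition calX : set (set X) :=
  [set E | hyperspace d E /\
     forall e : R, 0 < e -> exists y, hausdorff_dist d E (pi @^-1` [set y]) < e].

Definition calX_ball (E : set X) (e : R) : set (set X) :=
  [set F | calX F /\ hausdorff_dist d F E < e].

Definition pi_calX (B : set (set X)) : set Y := \bigcup_(E in B) (pi @` E).

End Hyper.

Definition calX_meas (R : realType) (X : Type) (dsp : measure_display)
  (Y : measurableType dsp) (d : X -> X -> R) (pi : X -> Y)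
  (nu : set Y -> \bar R) : set (set X) :=
  [set E | calX d pi E /\
     forall e : R, 0 < e -> (0 < nu (pi_calX pi (calX_ball d pi E e)))%E].

(* Main.v *)
Require Import Defs.
From HB Require Import structures.
From mathcomp Require Import all_boot all_order all_algebra.
From mathcomp Require Import finmap.
From mathcomp Require Import all_classical all_reals all_analysis.
From mathcomp Require Import measurable_realfun lra.
Set Implicit Arguments. Unset Strict Implicit. Unset Printing Implicit Defensive.
Import Order.TTheory GRing.Theory Num.Theory.
Import numFieldNormedType.Exports.
Local Open Scope classical_set_scope.
Local Open Scope ring_scope.

(* Let x_1, .., x_K be in E with neighborhoods U_k. For small e, every y in the
   set A := pi_calX (ball of radius e about E) has a fiber meeting all the U_k,
   and A is F_sigma, hence measurable, of positive measure a. By invariance of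
   nu_eq, each Folner set F_n admits a point y visiting A at a proportion at
   least a/2 of the f in F_n; the fiber of y then meets f^-1 U_k for all these f
   and all k. If a single g moves the given open set V so as to meet all these
   finitely many sets, then the translate F_n g contains a proportion a/2 of
   return times, and the F_n g again form a Folner sequence.

   The existence of g follows McMahon. A Folner limit of averages is a finitely
   additive invariant mean on X, and its powers are invariant means on X^n. For a
   closed invariant N in X x X^n the mean of the sections N x is constant by
   minimality, which makes x |-> N x continuous for the mean of the symmetric
   difference: an equicontinuous factor of X. Hence points of the same fiber of
   pi_eq have the same sections up to mean zero. Taking for N the orbit closure
   of an open box, one can move a neighborhood of x into a neighborhood of any
   x' in its fiber while n further open sets return to themselves. Repeating
   this brings all the sets f^-1 U_k simultaneously into V. *)

(** * Groups and the topology of a metric *)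

Lemma gmulVr (G : Type) (gG : grp G) (a : G) : gmul gG a (ginv gG a) = gone gG.
Proof.
rewrite -[LHS](gmul1 gG) -{1}(gmulV gG (ginv gG a)) -gmulA (gmulA _ _ a).
by rewrite gmulV gmul1 gmulV.
Qed.

Lemma gmulr1 (G : Type) (gG : grp G) (a : G) : gmul gG a (gone gG) = a.
Proof. by rewrite -(gmulV gG a) gmulA gmulVr gmul1. Qed.

Lemma gmulr_inj (G : Type) (gG : grp G) (g : G) : injective (fun x => gmul gG x g).
Proof.
move=> x y /= /(congr1 (fun z => gmul gG z (ginv gG g))).
by rewrite -!gmulA gmulVr !gmulr1.
Qed.

Lemma gmull_inj (G : Type) (gG : grp G) (g : G) : injective (gmul gG g).
Proof.
by move=> x y /(congr1 (gmul gG (ginv gG g))); rewrite !gmulA gmulV !gmul1.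
Qed.

Lemma mopenT (R : realType) (T : Type) (d : T -> T -> R) : mopen d setT.
Proof. by move=> x _; exists 1. Qed.

Lemma mopenI (R : realType) (T : Type) (d : T -> T -> R) (A B : set T) :
  mopen d A -> mopen d B -> mopen d (A `&` B).
Proof.
move=> oA oB x [/oA [r r0 rA] /oB [s s0 sB]].
exists (Num.min r s); first by rewrite lt_min r0 s0.
by move=> y; rewrite lt_min => /andP [/rA ? /sB ?].
Qed.

Lemma mopenU (R : realType) (T : Type) (d : T -> T -> R) (A B : set T) :
  mopen d A -> mopen d B -> mopen d (A `|` B).
Proof.
move=> oA oB x [/oA [r r0 rA]|/oB [r r0 rB]]; exists r => // y ?.
- by left; exact: rA.
- by right; exact: rB.
Qed.

Lemma mopen_preimage (R : realType) (T U : Type) (dT : T -> T -> R)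
    (dU : U -> U -> R) (f : T -> U) (A : set U) :
  mcontinuous dT dU f -> mopen dU A -> mopen dT (f @^-1` A).
Proof.
move=> cf oA x /oA [e e0 eA]; have [r r0 rP] := cf x e e0.
by exists r => // y /rP /eA.
Qed.

Lemma mopen_ball (R : realType) (T : Type) (d : T -> T -> R) (x : T) (r : R) :
  is_metric d -> mopen d [set y | d x y < r].
Proof.
move=> [_ _ _ tri] y /= xy; exists (r - d x y) => [|z yz]; first by rewrite subr_gt0.
by have := tri x y z; lra.
Qed.

Lemma mopen_far (R : realType) (T : Type) (d : T -> T -> R) (x : T) (r : R) :
  is_metric d -> mopen d [set y | r < d x y].
Proof.
move=> [_ _ sym tri] y /= xy; exists (d x y - r) => [|z yz]; first by rewrite subr_gt0.
by have := tri x z y; rewrite (sym z); lra.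
Qed.

Lemma mclosed_cball (R : realType) (T : Type) (d : T -> T -> R) (x : T) (r : R) :
  is_metric d -> mclosed d [set y | d x y <= r].
Proof.
move=> dm; rewrite /mclosed.
have -> : ~` [set y | d x y <= r] = [set y | r < d x y].
  by apply/seteqP; split => y /=; [move/negP; rewrite -ltNge|rewrite ltNge => /negP].
exact: mopen_far.
Qed.

Lemma dist_refl (R : realType) (T : Type) (d : T -> T -> R) (x : T) :
  is_metric d -> d x x = 0.
Proof. by move=> [_ d0 _ _]; apply/d0. Qed.

(** Compactness as an induction principle: the open sets satisfying [P] cover the space, and a
    finite subcover is glued by stability under unions. Most compactness arguments below take their
    local conclusion as [P]. *)
Lemma mcompact_ind (R : realType) (T : Type) (d : T -> T -> R) (P : set T -> Prop) :
  mcompact d -> P set0 ->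
  (forall A B, P A -> P B -> P (A `|` B)) ->
  (forall A B, A `<=` B -> P B -> P A) ->
  (forall x, exists2 U, mopen d U /\ U x & P U) -> P setT.
Proof.
move=> cpt P0 PU Psub Ploc.
pose I := {U : set T | mopen d U /\ P U}.
have [|x _|F finF cov] := cpt I (fun U => sval U).
- by case=> U [].
- by have [U [oU Ux] PUU] := Ploc x; exists (exist _ U (conj oU PUU)).
apply: (Psub _ _ cov).
have [s ->] := (finite_seqP (F : set {classic I})).1 finF.
elim: s => [|U s IHs]; first by apply: (Psub _ _ _ P0) => x [].
apply: (Psub _ _ _ (PU _ _ (svalP U).2 IHs)) => x [V /=].
by rewrite inE => /orP [/eqP -> ?|Vs Vx]; [left|right; exists V].
Qed.

(** * Products *)

(** Unlike in [dprod], the two factors may differ, so that products can be iterated. *)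
Definition pair_dist (R : realType) (A B : Type) (dA : A -> A -> R)
  (dB : B -> B -> R) (p q : A * B) : R := Num.max (dA p.1 q.1) (dB p.2 q.2).

Definition pair_act (G A B : Type) (actA : G -> A -> A) (actB : G -> B -> B)
  (g : G) (p : A * B) : A * B := (actA g p.1, actB g p.2).

Lemma pair_is_metric (R : realType) (A B : Type) (dA : A -> A -> R)
    (dB : B -> B -> R) :
  is_metric dA -> is_metric dB -> is_metric (pair_dist dA dB).
Proof.
move=> [A0 Ae As At] [B0 Be Bs Bt]; split; rewrite /pair_dist.
- by move=> p q; rewrite le_max A0.
- move=> [a b] [a' b'] /=; split=> [m0|[<- <-]]; last first.
    by rewrite (Ae a a).2 ?(Be b b).2 // maxxx.
  congr pair; [apply/Ae|apply/Be]; apply/eqP; rewrite eq_le ?A0 ?B0 andbT.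
  + by rewrite -m0 le_max lexx.
  + by rewrite -m0 le_max lexx orbT.
- by move=> p q; rewrite As Bs.
- move=> p q r; rewrite ge_max; apply/andP; split.
  + by apply: le_trans (At _ q.1 _) _; apply: lerD; rewrite le_max lexx.
  + by apply: le_trans (Bt _ q.2 _) _; apply: lerD; rewrite le_max lexx orbT.
Qed.

Lemma mopenX (R : realType) (A B : Type) (dA : A -> A -> R)
    (dB : B -> B -> R) (U : set A) (V : set B) :
  mopen dA U -> mopen dB V -> mopen (pair_dist dA dB) (U `*` V).
Proof.
move=> oU oV [a b] [/= /oU [r r0 rU] /oV [s s0 sV]].
exists (Num.min r s); first by rewrite lt_min r0 s0.
move=> [a' b']; rewrite /pair_dist /= lt_min !gt_max => /andP[/andP[h _] /andP[_ h']].
by split; [exact: rU|exact: sV].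
Qed.

Lemma pair_mcompact (R : realType) (A B : Type) (dA : A -> A -> R)
    (dB : B -> B -> R) :
  is_metric dA -> is_metric dB -> mcompact dA -> mcompact dB ->
  mcompact (pair_dist dA dB).
Proof.
move=> mA mB cA cB I U oU cov.
pose P S := exists2 F : set I, finite_set F & S `*` setT `<=` \bigcup_(i in F) U i.
suff [F finF FP] : P setT by exists F => // -[a b] _; exact: FP.
apply: (mcompact_ind cA).
- by exists set0 => // -[a b] [].
- move=> S S' [F finF FP] [F' finF' FP']; exists (F `|` F'); first by rewrite finite_setU.
  move=> p [/= [Sp|Sp] _].
  + by have [i Fi Uip] := FP p (conj Sp Logic.I); exists i => //; left.
  + by have [i Fi Uip] := FP' p (conj Sp Logic.I); exists i => //; right.
- move=> S S' sub [F finF FP]; exists F => // p [/sub Sp _]; exact: FP.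
move=> a.
(* Tube argument over a fixed [a]: one radius serves the whole finite subfamily that covers the
   slice. *)
pose Q S := exists2 F : set I, finite_set F &
  exists2 r, 0 < r & [set a' | dA a a' < r] `*` S `<=` \bigcup_(i in F) U i.
have [F finF [r r0 FP]] : Q setT.
  apply: (mcompact_ind cB).
  - by exists set0 => //; exists 1 => // -[a' b] [].
  - move=> S S' [F finF [r r0 FP]] [F' finF' [r' r'0 FP']].
    exists (F `|` F'); first by rewrite finite_setU.
    exists (Num.min r r'); first by rewrite lt_min r0.
    move=> p [/=]; rewrite lt_min => /andP[ar ar'] [Sp|Sp].
    + by have [i Fi Uip] := FP p (conj ar Sp); exists i => //; left.
    + by have [i Fi Uip] := FP' p (conj ar' Sp); exists i => //; right.
  - move=> S S' sub [F finF [r r0 FP]]; exists F => //; exists r => // p [? /sub Sp].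
    exact: FP.
  move=> b; have [i _ Uab] := cov (a, b) Logic.I.
  have [r r0 rU] := oU i _ Uab.
  exists [set b' | dB b b' < r].
    by split; [exact: mopen_ball|rewrite /= dist_refl].
  exists [set i] => //; exists r => // -[a' b'] [/= h h']; exists i => //.
  by apply: rU; rewrite /pair_dist gt_max h h'.
exists [set a' | dA a a' < r].
  by split; [exact: mopen_ball|rewrite /= dist_refl].
by exists F.
Qed.

Lemma pair_tds (R : realType) (G : Type) (gG : grp G) (A B : Type)
    (dA : A -> A -> R) (dB : B -> B -> R) (actA : G -> A -> A)
    (actB : G -> B -> B) :
  tds gG dA actA -> tds gG dB actB ->
  tds gG (pair_dist dA dB) (pair_act actA actB).
Proof.
move=> [mA cA oneA mulA contA] [mB cB oneB mulB contB]; split.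
- exact: pair_is_metric.
- exact: pair_mcompact.
- by move=> [a b]; rewrite /pair_act oneA oneB.
- by move=> g h [a b]; rewrite /pair_act mulA mulB.
- move=> g [a b] e e0; have [r r0 rP] := contA g a e e0.
  have [s s0 sP] := contB g b e e0; exists (Num.min r s); first by rewrite lt_min r0.
  move=> [a' b']; rewrite /pair_dist /= lt_min !gt_max.
  by move=> /andP[/andP[h _] /andP[_ h']]; rewrite rP // sP.
Qed.

(** * Group actions and minimality *)

Lemma actK (R : realType) (G : Type) (gG : grp G) (T : Type) (d : T -> T -> R)
    (act : G -> T -> T) (g : G) : tds gG d act -> cancel (act g) (act (ginv gG g)).
Proof. by move=> [_ _ one mul _] x; rewrite -mul gmulV one. Qed.

Lemma actVK (R : realType) (G : Type) (gG : grp G) (T : Type) (d : T -> T -> R)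
    (act : G -> T -> T) (g : G) : tds gG d act -> cancel (act (ginv gG g)) (act g).
Proof. by move=> [_ _ one mul _] x; rewrite -mul gmulVr one. Qed.

Lemma act_imageE (R : realType) (G : Type) (gG : grp G) (T : Type)
    (d : T -> T -> R) (act : G -> T -> T) (g : G) (A : set T) :
  tds gG d act -> act g @` A = act (ginv gG g) @^-1` A.
Proof.
move=> X; apply/seteqP; split=> [_ [x Ax <-] /=|x /= Ax].
  by rewrite (actK g X).
by exists (act (ginv gG g) x) => //; rewrite (actVK g X).
Qed.

Lemma mopen_act (R : realType) (G : Type) (gG : grp G) (T : Type)
    (d : T -> T -> R) (act : G -> T -> T) (g : G) (A : set T) :
  tds gG d act -> mopen d A -> mopen d (act g @` A).
Proof.
move=> X oA; rewrite (act_imageE _ _ X); case: X => _ _ _ _ cont.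
exact: mopen_preimage (cont _) oA.
Qed.

(* The points that never visit O form a closed invariant set. *)
Lemma minimal_visit (R : realType) (G : Type) (gG : grp G) (T : Type)
    (d : T -> T -> R) (act : G -> T -> T) (O : set T) :
  tds gG d act -> minimal d act -> mopen d O -> O !=set0 ->
  forall x, exists g, O (act g x).
Proof.
move=> X Xm oO [p Op] x; apply: contrapT => nvis.
pose Z := [set z | forall g, ~ O (act g z)].
suff ZT : Z = setT.
  have : Z p by rewrite ZT.
  by move/(_ (gone gG)); case: X => _ _ -> _ _.
apply: Xm => //.
- by exists x => g Og; apply: nvis; exists g.
- move=> z; rewrite /setC /= => /existsNP [g /contrapT Og].
  have [_ _ _ _ /(_ g) cont] := X.
  have [r r0 rP] := mopen_preimage cont oO Og.
  by exists r => // w /rP /= Ow; apply/existsNP; exists g; apply.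
- move=> g z Zz h; have [_ _ _ mul _] := X; rewrite -mul; exact: Zz.
Qed.

(** Compactness leaves finitely many of the preimages of [O]. This finiteness gives open sets
    positive mean, and their images in a factor nonempty interior. *)
Lemma minimal_cover (R : realType) (G : Type) (gG : grp G) (T : Type)
    (d : T -> T -> R) (act : G -> T -> T) (O : set T) :
  tds gG d act -> minimal d act -> mopen d O -> O !=set0 ->
  exists s : seq {classic G}, forall x, exists2 g, g \in s & O (act g x).
Proof.
move=> X Xm oO O0; have [_ cX _ _ cont] := X.
pose P S := exists s : seq {classic G}, forall x, S x -> exists2 g, g \in s & O (act g x).
suff [s sP] : P setT by exists s => x; apply: sP.
apply: (mcompact_ind cX).
- by exists [::].
- move=> A B [s sP] [t tP]; exists (s ++ t) => x [/sP|/tP] [g gs Og]; exists g => //;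
  by rewrite mem_cat gs ?orbT.
- by move=> A B sub [s sP]; exists s => x /sub /sP.
move=> x; have [g Og] := minimal_visit X Xm oO O0 x.
exists (act g @^-1` O); first by split => //; exact: mopen_preimage oO.
by exists [:: g] => y Oy; exists g; rewrite ?mem_head.
Qed.

(** The quotient of [X] by [rho] = 0 carries an invariant metric, hence is an equicontinuous factor;
    it factors through [pi] by maximality. *)
Lemma pseudometric_factor (R : realType) (G : Type) (gG : grp G)
    (X Y : Type) (d : X -> X -> R) (act : G -> X -> X)
    (dY : Y -> Y -> R) (actY : G -> Y -> Y) (pi : X -> Y) (rho : X -> X -> R) :
  tds gG d act -> max_equicontinuous_factor gG d act dY actY pi ->
  (forall x y, 0 <= rho x y) -> (forall x, rho x x = 0) ->
  (forall x y, rho x y = rho y x) ->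
  (forall x y z, rho x z <= rho x y + rho y z) ->
  (forall g x y, rho (act g x) (act g y) = rho x y) ->
  (forall x e, 0 < e -> exists2 r, 0 < r & forall y, d x y < r -> rho x y < e) ->
  forall x y, pi x = pi y -> rho x y = 0.
Proof.
move=> [_ cpt one mul _] [_ _ _ umax] ge0 refl sym tri inv cont.
have eq0 x y : rho x y = 0 -> forall z, rho x z = rho y z.
  move=> xy0 z; apply/eqP; rewrite eq_le; apply/andP; split.
    by have := tri x y z; rewrite xy0 add0r.
  by have := tri y x z; rewrite (sym y x) xy0 add0r.
(* Points of the quotient are the classes themselves, as subsets of [X]; distance and action are
   read off chosen representatives. *)
pose cls x := [set y | rho x y = 0].
pose Z := {A : set X | exists x, A = cls x}.
pose psi x : Z := exist _ (cls x) (ex_intro _ x erefl).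
have psiS z : exists x, z = psi x.
  by case: z => A [x xA]; exists x; apply: eq_exist.
have psiE x y : psi x = psi y <-> rho x y = 0.
  split=> [/(congr1 sval) /= xy|xy0].
    by have : cls x x := refl x; rewrite xy /cls /= sym.
  apply: eq_exist => /=; rewrite /cls; apply/seteqP; split=> z /=;
  by rewrite (eq0 _ _ xy0).
pose repr z := sval (cid (psiS z)).
have reprK z : psi (repr z) = z by rewrite /repr; case: cid => x /= ->.
pose dZ z w := rho (repr z) (repr w).
have dZE x y : dZ (psi x) (psi y) = rho x y.
  rewrite /dZ (eq0 _ x); last by apply/psiE; rewrite reprK.
  by rewrite sym (eq0 _ y) 1?sym //; apply/psiE; rewrite reprK.
pose actZ g z := psi (act g (repr z)).
have actZE g x : actZ g (psi x) = psi (act g x).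
  by apply/psiE; rewrite inv; apply/psiE; rewrite reprK.
have invZ g z w : dZ (actZ g z) (actZ g w) = dZ z w.
  by rewrite /actZ dZE inv.
have [|||phi _ phiE] := umax Z dZ actZ psi.
- split.
  + split.
    * by move=> z w; exact: ge0.
    * move=> z w; case: (psiS z) (psiS w) => x -> [y ->].
      by rewrite dZE psiE.
    * by move=> z w; exact: sym.
    * by move=> z w u; exact: tri.
  + move=> I U oU cov.
    have [i x /= /oU [r r0 rU]|x _|F finF FP] := cpt I (fun i => psi @^-1` U i).
    * have [s s0 sP] := cont x r r0.
      by exists s => // y xy; apply: rU; rewrite dZE sP.
    * exact: cov.
    * by exists F => // z _; have [x ->] := psiS z; exact: FP.
  + by move=> z; have [x ->] := psiS z; rewrite actZE one.
  + by move=> g h z; have [x ->] := psiS z; rewrite !actZE mul.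
  + by move=> g z e e0; exists e => // w; rewrite invZ.
- by move=> e e0; exists e => // z w zw g; rewrite invZ.
- split.
  + move=> x e e0; have [r r0 rP] := cont x e e0.
    by exists r => // y /rP; rewrite dZE.
  + by move=> z; have [x ->] := psiS z; exists x.
  + by move=> g x; rewrite actZE.
by move=> x y xy; apply/psiE; rewrite !phiE xy.
Qed.

(** * Invariant means *)

Definition bdd (R : realType) (T : Type) (f : T -> R) : Prop :=
  exists M, forall x, `|f x| <= M.

(* A finitely additive invariant probability charging every nonempty open set,
   seen as a functional on all bounded functions so that products are iterated
   integrals. *)
Record full_mean (R : realType) (G : Type) (Z : Type) (dZ : Z -> Z -> R)
    (actZ : G -> Z -> Z) (L : (Z -> R) -> R) : Prop := FullMean {
  mean_le : forall f g, bdd f -> bdd g -> (forall z, f z <= g z) -> L f <= L g;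
  mean_add : forall f g, bdd f -> bdd g -> L (fun z => f z + g z) = L f + L g;
  mean_scale : forall c f, bdd f -> L (fun z => c * f z) = c * L f;
  mean_one : L (fun=> 1) = 1;
  mean_act : forall g f, bdd f -> L (fun z => f (actZ g z)) = L f;
  mean_open : forall O, mopen dZ O -> O !=set0 -> 0 < L \1_O }.

Lemma bdd_indic (R : realType) (T : Type) (A : set T) : bdd (\1_A : T -> R).
Proof. by exists 1 => x; rewrite indicE; case: (_ \in _); rewrite ?normr1 ?normr0. Qed.

Lemma bdd_cst (R : realType) (T : Type) (c : R) : bdd (fun _ : T => c).
Proof. by exists `|c|. Qed.

Lemma bddD (R : realType) (T : Type) (f g : T -> R) :
  bdd f -> bdd g -> bdd (fun x => f x + g x).
Proof.
move=> [M fM] [N gN]; exists (M + N) => x.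
by apply: le_trans (ler_normD _ _) _; exact: lerD.
Qed.

Lemma bddZ (R : realType) (T : Type) (c : R) (f : T -> R) :
  bdd f -> bdd (fun x => c * f x).
Proof.
by move=> [M fM]; exists (`|c| * M) => x; rewrite normrM ler_wpM2l.
Qed.

Lemma bdd_comp (R : realType) (T U : Type) (h : T -> U) (f : U -> R) :
  bdd f -> bdd (fun x => f (h x)).
Proof. by move=> [M fM]; exists M => x. Qed.

Lemma mean_cst (R : realType) (G Z : Type) (dZ : Z -> Z -> R)
    (actZ : G -> Z -> Z) (L : (Z -> R) -> R) (c : R) :
  full_mean dZ actZ L -> L (fun=> c) = c.
Proof.
move=> ML; rewrite -{2}[c]mulr1 -(mean_one ML) -(mean_scale ML) //; last exact: bdd_cst.
by rewrite mulr1.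
Qed.

Lemma mean_norm_le (R : realType) (G Z : Type) (dZ : Z -> Z -> R)
    (actZ : G -> Z -> Z) (L : (Z -> R) -> R) (f : Z -> R) (M : R) :
  full_mean dZ actZ L -> (forall z, `|f z| <= M) -> `|L f| <= M.
Proof.
move=> ML fM; have bf : bdd f by exists M.
rewrite ler_norml; apply/andP; split.
- rewrite -[leLHS](mean_cst (- M) ML); apply: (mean_le ML) => // [|z]; first exact: bdd_cst.
  by have := fM z; rewrite ler_norml => /andP[].
- rewrite -[leRHS](mean_cst M ML); apply: (mean_le ML) => // [|z]; first exact: bdd_cst.
  by have := fM z; rewrite ler_norml => /andP[].
Qed.

(** The order of integration is fixed, so each clause passes from the inner mean to the outer one
    without any exchange. *)
Lemma pair_full_mean (R : realType) (G A B : Type) (dA : A -> A -> R)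
    (dB : B -> B -> R) (actA : G -> A -> A) (actB : G -> B -> B)
    (LA : (A -> R) -> R) (LB : (B -> R) -> R) :
  is_metric dA -> is_metric dB -> full_mean dA actA LA -> full_mean dB actB LB ->
  full_mean (pair_dist dA dB) (pair_act actA actB)
    (fun f => LA (fun a => LB (fun b => f (a, b)))).
Proof.
move=> mA mB MA MB.
have sec f a : bdd f -> bdd (fun b : B => f (a, b) : R) by exact: bdd_comp.
have inn f : bdd f -> bdd (fun a : A => LB (fun b => f (a, b))).
  by move=> [M fM]; exists M => a; apply: (mean_norm_le MB).
split.
- move=> f g bf bg fg; apply: (mean_le MA) => [||a]; [exact: inn|exact: inn|].
  by apply: (mean_le MB) => [||b]; [exact: sec|exact: sec|].
- move=> f g bf bg; rewrite -(mean_add MA); [|exact: inn|exact: inn].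
  congr LA; apply/funext => a; rewrite -(mean_add MB) //; exact: sec.
- move=> c f bf; rewrite -(mean_scale MA); last exact: inn.
  congr LA; apply/funext => a; rewrite -(mean_scale MB) //; exact: sec.
- rewrite -[RHS](mean_one MA); congr LA; apply/funext => a; exact: mean_one MB.
- move=> g f bf; rewrite -[RHS](mean_act MA g); last exact: inn.
  congr LA; apply/funext => a; exact: (mean_act MB g (sec _ f (actA g a) bf)).
(* [O] contains a box, and the iterated mean of its indicator is the product of the means of the two
   sides. *)
- move=> O oO [[a b] Oab]; have [r r0 rO] := oO _ Oab.
  pose U := [set a' | dA a a' < r]; pose V := [set b' | dB b b' < r].
  have U0 : 0 < LA \1_U.
    by apply: (mean_open MA); [exact: mopen_ball|exists a; rewrite /U /= dist_refl].
  have V0 : 0 < LB \1_V.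
    by apply: (mean_open MB); [exact: mopen_ball|exists b; rewrite /V /= dist_refl].
  apply: lt_le_trans (mulr_gt0 V0 U0) _; rewrite -(mean_scale MA); last exact: bdd_indic.
  apply: (mean_le MA); first by apply: bddZ; exact: bdd_indic.
    by apply: inn; exact: bdd_indic.
  move=> a'; rewrite indicE mulrC -(mean_scale MB); last exact: bdd_indic.
  apply: (mean_le MB); first by apply: bddZ; exact: bdd_indic.
    by apply: sec; exact: bdd_indic.
  move=> b'; rewrite !indicE -natrM ler_nat mulnb.
  case: (boolP ((a' \in U) && (b' \in V))) => // /andP[]; rewrite !inE => /= Ua Vb.
  by rewrite mem_set //; apply: rO; rewrite /pair_dist gt_max Ua Vb.
Qed.

(** * Outer means of sets *)

Section Content.
Context (R : realType) (G : Type) (gG : grp G) (Z : Type) (dZ : Z -> Z -> R)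
  (actZ : G -> Z -> Z) (L : (Z -> R) -> R).
Hypotheses (Ztds : tds gG dZ actZ) (ML : full_mean dZ actZ L).

Lemma mean_indic_le (A B : set Z) : A `<=` B -> L \1_A <= L \1_B.
Proof.
move=> AB; apply: (mean_le ML) => [||z]; [exact: bdd_indic|exact: bdd_indic|].
rewrite !indicE ler_nat; case: (boolP (z \in A)) => //; rewrite inE => /AB Bz.
by rewrite mem_set.
Qed.

Lemma mean_indicUI (A B : set Z) :
  L \1_(A `|` B) + L \1_(A `&` B) = L \1_A + L \1_B.
Proof.
rewrite -!(mean_add ML); try exact: bdd_indic.
congr L; apply/funext => z; rewrite !indicE in_setU in_setI -!natrD.
by case: (z \in A); case: (z \in B).
Qed.

(** Approximation from outside by open sets makes the value upper semicontinuous along the sections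
    of a closed set, which a finitely additive mean need not be. *)
Definition outer_mean (C : set Z) : R :=
  inf [set L \1_O | O in [set O | mopen dZ O /\ C `<=` O]].

Lemma mean_indic_ge0 (A : set Z) : 0 <= L \1_A.
Proof.
rewrite -(mean_cst 0 ML); apply: (mean_le ML) => [||z]; [exact: bdd_cst|exact: bdd_indic|].
by rewrite indicE ler0n.
Qed.

Lemma outer_mean_le (C O : set Z) : mopen dZ O -> C `<=` O -> outer_mean C <= L \1_O.
Proof.
move=> oO CO; apply: ge_inf; last by exists O.
by exists 0 => _ [A _ <-]; exact: mean_indic_ge0.
Qed.

Lemma outer_mean_ge (C : set Z) (c : R) :
  (forall O, mopen dZ O -> C `<=` O -> c <= L \1_O) -> c <= outer_mean C.
Proof.
move=> H; apply: lb_le_inf.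
  by exists (L \1_setT), setT => //; split => //; exact: mopenT.
by move=> _ [A [oA CA] <-]; exact: H.
Qed.

Lemma outer_mean_lt (C : set Z) (c : R) : outer_mean C < c ->
  exists O, [/\ mopen dZ O, C `<=` O & L \1_O < c].
Proof.
move=> lt; apply: contrapT => nO; move: lt; apply/negP; rewrite -leNgt.
apply: outer_mean_ge => O oO CO; rewrite leNgt; apply/negP => lt.
by apply: nO; exists O.
Qed.

Lemma outer_mean_mono (A B : set Z) : A `<=` B -> outer_mean A <= outer_mean B.
Proof.
move=> AB; apply: outer_mean_ge => O oO BO; apply: outer_mean_le => //.
exact: subset_trans BO.
Qed.

(** Modularity on open sets passes to infima as an inequality; it is the source of the triangle
    inequality in [fiber_recurrence]. *)
Lemma outer_mean_submod (A B : set Z) :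
  outer_mean (A `|` B) + outer_mean (A `&` B) <= outer_mean A + outer_mean B.
Proof.
apply/ler_addgt0Pr => e e0; have e2 : 0 < e / 2 by lra.
have [|O [oO AO ltO]] := @outer_mean_lt A (outer_mean A + e / 2); first by lra.
have [|Q [oQ BQ ltQ]] := @outer_mean_lt B (outer_mean B + e / 2); first by lra.
have h1 : outer_mean (A `|` B) <= L \1_(O `|` Q).
  by apply: outer_mean_le; [exact: mopenU|exact: setUSS].
have h2 : outer_mean (A `&` B) <= L \1_(O `&` Q).
  by apply: outer_mean_le; [exact: mopenI|exact: setISS].
by have := mean_indicUI O Q; lra.
Qed.

(** An open set around [D] pulls back under [g] to an open set around [C] of the same mean. *)
Lemma outer_mean_act (g : G) (C D : set Z) :
  (forall z, C z -> D (actZ g z)) -> outer_mean C <= outer_mean D.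
Proof.
move=> CD; apply: outer_mean_ge => O oO DO.
have [_ _ _ _ /(_ g) cont] := Ztds.
rewrite -(mean_act ML g); last exact: bdd_indic.
have -> : (fun z => \1_O (actZ g z)) = \1_(actZ g @^-1` O) :> (Z -> R).
  by apply/funext => z; rewrite !indicE; congr (nat_of_bool _)%:R;
    apply/idP/idP; rewrite !inE.
by apply: outer_mean_le; [exact: mopen_preimage oO|move=> z /CD /DO].
Qed.

End Content.

(** * Fibers of the maximal equicontinuous factor *)

(* McMahon's argument: for the closed invariant set N generated by V x O, the
   outer mean of the section N x is an upper semicontinuous invariant function
   of x, hence constant, so rho x y := outer_mean (N x `|` N y) - c is a
   continuous invariant pseudometric and vanishes on fibers. *)
Lemma fiber_recurrence (R : realType) (G : Type) (gG : grp G)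
    (X Y Z : Type) (d : X -> X -> R) (act : G -> X -> X)
    (dY : Y -> Y -> R) (actY : G -> Y -> Y) (pi : X -> Y)
    (dZ : Z -> Z -> R) (actZ : G -> Z -> Z) (L : (Z -> R) -> R)
    (x0 x1 : X) (V U : set X) (O : set Z) :
  tds gG d act -> minimal d act -> max_equicontinuous_factor gG d act dY actY pi ->
  tds gG dZ actZ -> full_mean dZ actZ L -> pi x0 = pi x1 ->
  mopen d V -> V x0 -> mopen d U -> U x1 -> mopen dZ O -> O !=set0 ->
  exists g, (act g @` V) `&` U !=set0 /\ (actZ g @` O) `&` O !=set0.
Proof.
move=> Xt Xm pimax Zt ML pi01 oV Vx0 oU Ux1 oO O0.
have [mX cX one mul cont] := Xt; have [mZ cZ oneZ mulZ contZ] := Zt.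
(* [N] is the closure of the union of all diagonal translates of V x O. *)
pose N x z := forall r : R, 0 < r -> exists g v o,
  [/\ V v, O o, d x (act g v) < r & dZ z (actZ g o) < r].
pose lam := outer_mean dZ L.
have Nclosed x z : ~ N x z -> exists2 r, 0 < r &
    forall x' z', d x x' < r -> dZ z z' < r -> ~ N x' z'.
  move=> /existsNP [r /not_implyP [r0 nN]]; exists (r / 2); first by lra.
  move=> x' z' xx' zz' /(_ (r / 2)) []; first by lra.
  move=> g [v [q [Vv Oq h h']]]; apply: nN; exists g, v, q; split => //.
    by have [_ _ _ tri] := mX; have := tri x x' (act g v); lra.
  by have [_ _ _ tri] := mZ; have := tri z z' (actZ g q); lra.
have Ninv h x z : N x z -> N (act h x) (actZ h z).
  move=> Nxz r r0; have [s s0 sP] := cont h x r r0; have [t t0 tP] := contZ h z r r0.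
  have [|g [v [q [Vv Oq]]]] := Nxz (Num.min s t); first by rewrite lt_min s0.
  rewrite !lt_min => /andP[/sP gv _] /andP[_ /tP go].
  by exists (gmul gG h g), v, q; rewrite mul mulZ.
(* Upper semicontinuity of the sections, from closedness of [N] and compactness of [Z]. *)
have tube x Q : mopen dZ Q -> N x `<=` Q ->
    exists2 r, 0 < r & forall x', d x x' < r -> N x' `<=` Q.
  move=> oQ NQ; pose P S := exists2 r, 0 < r & forall x', d x x' < r -> N x' `&` S `<=` Q.
  suff [r r0 rP] : P setT by exists r => // x' /rP; rewrite setIT.
  apply: (mcompact_ind cZ).
  - by exists 1 => // x' _; rewrite setI0.
  - move=> A B [r r0 rP] [s s0 sP]; exists (Num.min r s); first by rewrite lt_min r0.
    move=> x'; rewrite lt_min setIUr => /andP[/rP h /sP h'].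
    by rewrite subUset.
  - move=> A B AB [r r0 rP]; exists r => // x' /rP; apply: subset_trans.
    exact: setIS.
  move=> z; have [Nxz|/Nclosed [r r0 rP]] := pselect (N x z).
    by exists Q; [split => //; exact: NQ|exists 1 => // x' _ w []].
  exists [set w | dZ z w < r]; first by split; [exact: mopen_ball|rewrite /= dist_refl].
  by exists r => // x' xx' w [Nxw zw]; case: (rP _ _ xx' zw Nxw).
(* The points with outer mean at least that at [x] form a closed set by [tube], invariant and
   containing [x]; minimality makes it everything. *)
have lamle x y : lam (N x) <= lam (N y).
  pose S := [set y | lam (N x) <= lam (N y)].
  suff ST : S = setT by have : S y by rewrite ST.
  apply: Xm => //.
  - by exists x; exact: lexx.
  - move=> w /negP; rewrite -ltNge => /outer_mean_lt [Q [oQ NQ ltQ]].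
    have [r r0 rP] := tube w Q oQ NQ; exists r => // w' /rP NQ'; apply/negP.
    by rewrite -ltNge; apply: le_lt_trans ltQ; exact: (outer_mean_le ML).
  - move=> g w; rewrite /S /= => h; apply: le_trans h _.
    by apply: (outer_mean_act Zt ML (g := g)) => z; exact: Ninv.
have lamE x y : lam (N x) = lam (N y) by apply/eqP; rewrite eq_le !lamle.
pose c := lam (N x0).
pose rho x y := lam (N x `|` N y) - c.
have rho0 : rho x0 x1 = 0.
  apply: (pseudometric_factor Xt pimax) => //.
  - move=> x y; rewrite subr_ge0 /c (lamE x0 x); apply: (outer_mean_mono ML).
    exact: subsetUl.
  - by move=> x; rewrite /rho setUid /c (lamE x0 x) subrr.
  - by move=> x y; rewrite /rho setUC.
  - move=> x y z; rewrite /rho /c.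
    (* The intersection of the two unions contains [N y], whose outer mean is the constant [c]. *)
    have h1 := outer_mean_submod ML (N x `|` N y) (N y `|` N z).
    have h2 : lam (N x `|` N z) <= lam ((N x `|` N y) `|` (N y `|` N z)).
      by apply: (outer_mean_mono ML) => w [Nw|Nw]; [left; left|right; right].
    have h3 : lam (N y) <= lam ((N x `|` N y) `&` (N y `|` N z)).
      by apply: (outer_mean_mono ML) => w Nw; split; [right|left].
    by have h4 := lamE x0 y; rewrite -/lam in h1; lra.
  - move=> g x y; rewrite /rho; congr (_ - _); apply/eqP; rewrite eq_le.
    apply/andP; split.
      apply: (outer_mean_act Zt ML (g := ginv gG g)) => z [/(Ninv (ginv gG g))|/(Ninv (ginv gG g))];
      rewrite (actK g Xt) => ?; [by left|by right].
    apply: (outer_mean_act Zt ML (g := g)) => z.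
    by move=> [/(Ninv g)|/(Ninv g)] ?; [left|right].
  - move=> x e e0.
    have [|Q [oQ NQ ltQ]] := @outer_mean_lt _ _ dZ L (N x) (c + e).
      by rewrite -/lam (lamE x x0); rewrite ltrDl.
    have [r r0 rP] := tube x Q oQ NQ; exists r => // y /rP NyQ.
    rewrite /rho ltrBlDl; apply: le_lt_trans ltQ; apply: (outer_mean_le ML) => //.
    by rewrite subUset.
(* Without such a [g], the section at [x1] misses [O] while the one at [x0] contains it; their union
   then has outer mean above [c], against [rho0]. *)
apply: contrapT => nog.
have disj z : O z -> ~ N x1 z.
  move=> Oz Nz; have [r r0 rP] := oU _ Ux1; have [s s0 sP] := oO _ Oz.
  have [|g [v [q [Vv Oq]]]] := Nz (Num.min r s); first by rewrite lt_min r0.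
  rewrite !lt_min => /andP[/rP gv _] /andP[_ /sP go]; apply: nog; exists g.
  by split; [exists (act g v)|exists (actZ g q)]; split => //.
have ON z : O z -> N x0 z.
  move=> Oz r r0; exists (gone gG), x0, z; split => //.
    by rewrite one dist_refl.
  by rewrite oneZ dist_refl.
have [p Op] := O0; have [r r0 rO] := oO _ Op.
have r20 : 0 < r / 2 by lra.
(* Removing the closed ball [C] from an open [Q] leaves an open neighborhood of [N x1]; the open
   ball [B] in [C] shows that the removed part has positive mean. *)
pose B := [set z | dZ p z < r / 2]; pose C := [set z | dZ p z <= r / 2].
have B0 : 0 < L \1_B.
  apply: (mean_open ML); first exact: mopen_ball.
  by exists p; rewrite /B /= dist_refl.
have CO z : C z -> O z by move=> Cz; apply: rO; move: Cz; rewrite /C /=; lra.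
suff : c + L \1_B <= lam (N x0 `|` N x1) by move: rho0; rewrite /rho; lra.
apply: outer_mean_ge => Q oQ; rewrite subUset => -[NQ0 NQ1].
have BC : L \1_B <= L \1_C by apply: (mean_indic_le ML) => z; exact: ltW.
have : lam (N x1) <= L \1_(Q `&` ~` C).
  apply: (outer_mean_le ML); first by apply: mopenI => //; exact: mclosed_cball.
  by move=> z Nz; split; [exact: NQ1|move=> /CO /disj].
have := mean_indicUI ML (Q `&` ~` C) C.
rewrite -setIA setICl setI0.
have -> : L \1_(@set0 Z) = 0.
  by rewrite indic0; exact: (mean_cst 0 ML).
have -> : Q `&` ~` C `|` C = Q.
  apply/seteqP; split=> z; first by case=> [[]|/CO /ON /NQ0].
  by move=> Qz; have [|] := pselect (C z); [right|left].
by have := lamE x0 x1; rewrite /c; lra.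
Qed.

(** A return of the box of the [Ws] in a power of [X] is a simultaneous return of all of them. *)
Lemma fiber_recurrence_seq (R : realType) (G : Type) (gG : grp G)
    (X Y : Type) (d : X -> X -> R) (act : G -> X -> X)
    (dY : Y -> Y -> R) (actY : G -> Y -> Y) (pi : X -> Y) (L : (X -> R) -> R)
    (x0 x1 : X) (V U : set X) (Ws : seq (set X)) :
  tds gG d act -> minimal d act -> max_equicontinuous_factor gG d act dY actY pi ->
  full_mean d act L -> pi x0 = pi x1 ->
  mopen d V -> V x0 -> mopen d U -> U x1 ->
  (forall W, W \in Ws -> mopen d W /\ W !=set0) ->
  exists g, (act g @` V) `&` U !=set0 /\
    forall W, W \in Ws -> (act g @` W) `&` W !=set0.
Proof.
move=> Xt Xm pimax ML pi01 oV Vx0 oU Ux1.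
(* The list is absorbed one set at a time: [Z] becomes Z x X and [O] becomes O x W, so both must be
   general in the induction. *)
suff gen : forall (Z : Type) (dZ : Z -> Z -> R) (actZ : G -> Z -> Z)
    (LZ : (Z -> R) -> R) (O : set Z), tds gG dZ actZ -> full_mean dZ actZ LZ ->
    mopen dZ O -> O !=set0 -> (forall W, W \in Ws -> mopen d W /\ W !=set0) ->
    exists g, [/\ (act g @` V) `&` U !=set0, (actZ g @` O) `&` O !=set0 &
      forall W, W \in Ws -> (act g @` W) `&` W !=set0].
  move=> Wop; have [|g [? _ ?]] := gen X d act L setT Xt ML (mopenT _) _ Wop.
    by exists x0.
  by exists g.
elim: Ws => [|W Ws IH] Z dZ actZ LZ O Zt MZ oO O0 Wop.
  have [g [? ?]] := fiber_recurrence Xt Xm pimax Zt MZ pi01 oV Vx0 oU Ux1 oO O0.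
  by exists g; split.
have [oW [w Ww]] := Wop W (mem_head _ _); have [p Op] := O0.
have [mX _ _ _ _] := Xt; have [mZ _ _ _ _] := Zt.
have [|W' W's|g [gV [_ [[[z w'] [/= Oz Ww'] <-] [/= Ogz Wgw]]] gW]] :=
    IH _ _ _ _ (O `*` W) (pair_tds Zt Xt) (pair_full_mean mZ mX MZ ML) (mopenX oO oW).
- by exists (p, w).
- by apply: Wop; rewrite inE W's orbT.
exists g; split => //.
  by exists (actZ g z); split => //; exists z.
move=> W'; rewrite inE => /orP [/eqP ->|]; last exact: gW.
by exists (act g w'); split => //; exists w'.
Qed.

(** * Images in the factor and visits to a fiber *)

Lemma mclosed_image (R : realType) (X Y : Type) (d : X -> X -> R)
    (dY : Y -> Y -> R) (f : X -> Y) (C : set X) :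
  is_metric dY -> mcompact d -> mcontinuous d dY f -> mclosed d C ->
  mclosed dY (f @` C).
Proof.
move=> mY cX cf cC y nfy; have [Y0 Ye Ysym Ytri] := mY.
pose P S := exists2 r, 0 < r & forall y' x, dY y y' < r -> S x -> C x -> f x <> y'.
have [r r0 rP] : P setT.
  apply: (mcompact_ind cX).
  - by exists 1.
  - move=> A B [r r0 rP] [s s0 sP]; exists (Num.min r s); first by rewrite lt_min r0.
    by move=> y' x; rewrite lt_min => /andP[? ?] [?|?]; [exact: rP|exact: sP].
  - by move=> A B AB [r r0 rP]; exists r => // y' x ? /AB; exact: rP.
  move=> x; have [Cx|nCx] := pselect (C x); last first.
    by exists (~` C) => //; exists 1 => // y' w _ nCw.
  have e0 : 0 < dY (f x) y.
    rewrite lt_neqAle Y0 andbT eq_sym; apply/eqP => /Ye fxy.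
    by apply: nfy; exists x.
  exists (f @^-1` [set y' | dY (f x) y' < dY (f x) y / 2]).
    split; first by apply: (mopen_preimage cf); exact: mopen_ball.
    by rewrite /= dist_refl // divr_gt0.
  exists (dY (f x) y / 2); first by rewrite divr_gt0.
  move=> y' w yy' /= fw _ fwy; rewrite fwy in fw.
  by have := Ytri (f x) y' y; rewrite (Ysym y' y); lra.
by exists r => // y' yy' [x Cx]; exact: rP.
Qed.

(** Either the first closed set contains [O], or removing it leaves a nonempty open set covered by
    the others. *)
Lemma finite_baire (R : realType) (Y : Type) (dY : Y -> Y -> R) (I : eqType)
    (K : I -> set Y) (s : seq I) (O : set Y) :
  (forall i, mclosed dY (K i)) -> mopen dY O -> O !=set0 ->
  (forall y, O y -> exists2 i, i \in s & K i y) ->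
  exists i Q, [/\ mopen dY Q, Q !=set0 & Q `<=` K i].
Proof.
move=> cK; elim: s O => [|i s IH] O oO [y Oy] cov; first by have [] := cov y Oy.
have [OK|] := pselect (O `<=` K i); first by exists i, O; split => //; exists y.
move=> /existsNP [z /not_implyP [Oz nKz]].
apply: (IH (O `&` ~` K i)); first by apply: mopenI => //; exact: cK.
  by exists z.
by move=> w [Ow nKw]; have [j] := cov w Ow; rewrite inE => /orP [/eqP -> //|]; exists j.
Qed.

(** Finitely many translates of a small ball cover [X], so the image of one of them has interior by
    [finite_baire]; minimality then carries this interior over [y]. *)
Lemma factor_interior (R : realType) (G : Type) (gG : grp G) (X Y : Type)
    (d : X -> X -> R) (act : G -> X -> X) (dY : Y -> Y -> R)
    (actY : G -> Y -> Y) (pi : X -> Y) (V : set X) (y : Y) :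
  tds gG d act -> minimal d act -> tds gG dY actY ->
  factor_map d act dY actY pi -> mopen d V -> V !=set0 ->
  exists h, exists2 r, 0 < r &
    forall y', dY y y' < r -> exists2 v, V v & pi (act h v) = y'.
Proof.
move=> Xt Xm Yt [cpi spi epi] oV [p Vp].
have [mX cX _ mul cont] := Xt; have [mY _ oneY mulY contY] := Yt.
have [r r0 rV] := oV _ Vp; have r20 : 0 < r / 2 by rewrite divr_gt0.
(* The open ball [B] serves for [minimal_cover]; the closed ball [C] has closed images. *)
pose B := [set x | d p x < r / 2]; pose C := [set x | d p x <= r / 2].
have CV x : C x -> V x by rewrite /C /= => Cx; apply: rV; lra.
have [|s sP] := minimal_cover Xt Xm (O := B) (mopen_ball mX).
  by exists p; rewrite /B /= dist_refl.
pose K g := pi @` (act g @^-1` C).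
have cK g : mclosed dY (K g).
  apply: (mclosed_image mY cX cpi); rewrite /mclosed preimage_setC.
  by apply: (mopen_preimage (cont g)); exact: mclosed_cball.
have [|w _|g [Q [oQ [q Qq] QK]]] := finite_baire cK (mopenT dY) _ (s := s).
- by exists (pi p).
- have [x <-] := spi w; have [g gs Bg] := sP x; exists g => //; exists x => //.
  exact: ltW Bg.
have [x xy] := spi y; have [q' q'q] := spi q.
have [|k Qk] := minimal_visit Xt Xm (mopen_preimage cpi oQ) _ x.
  by exists q'; rewrite /= q'q.
rewrite /= epi xy in Qk.
have [s' s'0 sQ] := mopen_preimage (contY k) oQ Qk.
(* This undoes both moves: [g] takes [z] into [C], and [k] takes [y'] to the image of [z]. *)
exists (gmul gG (ginv gG k) (ginv gG g)), s' => // y' /sQ /QK [z Cz zk].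
exists (act g z); first exact: CV.
by rewrite mul (actK g Xt) epi zk (actK k Yt).
Qed.

(** Induction on [Us]: the next [U] is first made to return to itself, then its return set is pushed
    into [V] by [fiber_recurrence_seq]. The inclusion of images supplies a point of [V] in the
    required fiber. *)
Lemma simultaneous_visit (R : realType) (G : Type) (gG : grp G)
    (X Y : Type) (d : X -> X -> R) (act : G -> X -> X)
    (dY : Y -> Y -> R) (actY : G -> Y -> Y) (pi : X -> Y) (L : (X -> R) -> R)
    (V : set X) (Us Ws : seq (set X)) :
  tds gG d act -> minimal d act -> max_equicontinuous_factor gG d act dY actY pi ->
  full_mean d act L -> mopen d V ->
  (forall U, U \in Us -> [/\ mopen d U, U !=set0 & pi @` U `<=` pi @` V]) ->
  (forall W, W \in Ws -> mopen d W /\ W !=set0) ->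
  exists g, (forall U, U \in Us -> (act g @` U) `&` V !=set0) /\
    forall W, W \in Ws -> (act g @` W) `&` W !=set0.
Proof.
move=> Xt Xm pimax ML oV; have [_ _ one mul _] := Xt.
elim: Us Ws => [|U Us IH] Ws UP WP.
  exists (gone gG); split => // W /WP [_ [w Ww]]; exists w; split => //.
  by exists w => //; rewrite one.
have [oU U0 UV] := UP U (mem_head _ _).
have [U' U's|W|g [gU gW]] := IH (U :: Ws).
- by apply: UP; rewrite inE U's orbT.
- by rewrite inE => /orP [/eqP ->|/WP].
have [a [gUa Ua]] := gW U (mem_head _ _).
have [v Vv va] : (pi @` V) (pi a) by apply: UV; exists a.
(* The second move [h] is asked to let the intersections achieved by [g] recur, so that the product
   hg keeps all earlier visits. *)
pose ret O := (act g @` O) `&` O; pose hit O := (act g @` O) `&` V.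
have oA : mopen d (ret U) := mopenI (mopen_act Xt oU) oU.
have Aa : ret U a by [].
have [W'|h [[b [[b' [[u Uu ub'] _] b'b] Vb]] hW]] :=
  fiber_recurrence_seq (Ws := map hit Us ++ map ret Ws) Xt Xm pimax ML (esym va) oA Aa oV Vv.
- rewrite mem_cat => /orP [/mapP [W Wi ->]|/mapP [W Wi ->]].
  + have [oW _ _] : [/\ mopen d W, W !=set0 & pi @` W `<=` pi @` V].
      by apply: UP; rewrite inE Wi orbT.
    by split; [exact: (mopenI (mopen_act Xt oW) oV)|exact: gU].
  + have [oW _] := WP W Wi.
    split; [exact: (mopenI (mopen_act Xt oW) oW)|apply: gW].
    by rewrite inE Wi orbT.
exists (gmul gG h g); split=> [U'|W Wi].
- rewrite inE => /orP [/eqP ->|U'i].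
    by exists b; split => //; exists u => //; rewrite mul ub'.
  have [|c [[c' [[w Ww wc'] _] c'c] [_ Vc]]] := hW (hit U').
    by rewrite mem_cat map_f.
  by exists c; split => //; exists w => //; rewrite mul wc'.
- have [|c [[c' [[w Ww wc'] _] c'c] [_ Wc]]] := hW (ret W).
    by rewrite mem_cat (map_f ret) ?orbT.
  by exists c; split => //; exists w => //; rewrite mul wc'.
Qed.

(** [factor_interior] gives a translate of [V] whose image covers a ball around [y]; cutting each
    [U] down to the points over this ball yields the inclusion of images needed for
    [simultaneous_visit]. *)
Lemma fiber_visit (R : realType) (G : Type) (gG : grp G)
    (X Y : Type) (d : X -> X -> R) (act : G -> X -> X)
    (dY : Y -> Y -> R) (actY : G -> Y -> Y) (pi : X -> Y) (L : (X -> R) -> R)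
    (V : set X) (y : Y) (Us : seq (set X)) :
  tds gG d act -> minimal d act -> max_equicontinuous_factor gG d act dY actY pi ->
  full_mean d act L -> mopen d V -> V !=set0 ->
  (forall U, U \in Us -> mopen d U /\ U `&` pi @^-1` [set y] !=set0) ->
  exists g, forall U, U \in Us -> (act g @` V) `&` U !=set0.
Proof.
move=> Xt Xm pimax ML oV V0 UP.
have [Yt _ pif _] := pimax; have [cpi _ _] := pif; have [mY _ _ _ _] := Yt.
have [h [r r0 rP]] := factor_interior y Xt Xm Yt pif oV V0.
pose near U := U `&` pi @^-1` [set y' | dY y y' < r].
have onear U : mopen d U -> mopen d (near U).
  by move=> oU; apply: mopenI => //; apply: (mopen_preimage cpi); exact: mopen_ball.
have [_ /mapP [U Ui ->]||g [gU _]] := simultaneous_visit (V := act h @` V)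
    (Us := map near Us) (Ws := [::]) Xt Xm pimax ML (mopen_act Xt oV).
- have [oU [x [Ux xy]]] := UP U Ui; split; first exact: onear.
    by exists x; split => //; rewrite /= xy dist_refl.
  move=> _ [x' [_ /rP [v Vv <-]] <-]; by exists (act h v) => //; exists v.
- by [].
(* The visits found go from [U] to hV; inverting [g] turns them into visits from [V] to [U]. *)
exists (gmul gG (ginv gG g) h) => U Ui.
have [|_ [[u [Uu _] <-] [v Vv vu]]] := gU (near U); first by rewrite map_f.
exists u; split => //; exists v => //.
by have [_ _ _ mul _] := Xt; rewrite mul vu (actK g Xt).
Qed.

(** * Means from Folner averages *)

Lemma ultra_cvg_bdd (R : realType) (T : Type) (U : set_system T) (u : T -> R) :
  UltraFilter U -> bdd u -> u @ U --> lim (u @ U).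
Proof.
move=> UU [M uM]; have PU : ProperFilter U := ultra_proper.
have [|p [_ clp]] := @segment_compact R (- M) M (u @ U) _.
  by apply: (@filterS _ U _ setT) filterT => n _ /=; rewrite in_itv /= -ler_norml uM.
suff up : u @ U --> p by rewrite (cvg_lim (@Rhausdorff R) up).
move=> A pA; have [//|nA] := in_ultra_setVsetC (u @^-1` A) UU.
by have [q []] := clp (~` A) A nA pA.
Qed.

(** The terms over the common part of [F] and its translate cancel, so only the symmetric difference
    contributes. *)
Lemma folner_sum_le (R : realType) (G : choiceType) (gG : grp G) (F : {fset G})
    (g : G) (f : G -> R) (M : R) : F != fset0 -> (forall x, `|f x| <= M) ->
  `|(\sum_(x <- F) f (gmul gG g x)) / #|` F|%:R - (\sum_(x <- F) f x) / #|` F|%:R|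
    <= M * folner_ratio R gG g F.
Proof.
move=> F0 fM; have cF : 0 < (#|` F|%:R : R) by rewrite ltr0n cardfs_gt0.
rewrite -mulrBl normrM normfV (gtr0_norm cF) /folner_ratio mulrA ler_pM2r ?invr_gt0 //.
set gF := ltranslate gG g F.
have -> : \sum_(x <- F) f (gmul gG g x) = \sum_(x <- gF) f x.
  by rewrite big_imfset //= => x y _ _; exact: gmull_inj.
have split_sum (A B : {fset G}) :
    \sum_(x <- A) f x = \sum_(x <- (A `&` B)%fset) f x + \sum_(x <- (A `\` B)%fset) f x.
  rewrite (big_fsetID _ (mem B)) /=; congr (_ + _); congr (\sum_(x <- enum_fset _) _);
  by apply/fsetP => x; rewrite !inE // andbC.
have bound (A : {fset G}) : `|\sum_(x <- A) f x| <= M * #|` A|%:R.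
  apply: le_trans (ler_norm_sum _ _ _) _.
  apply: le_trans (ler_sum _ (fun i _ => fM i)) _.
  by rewrite big_const_seq count_predT iter_addr_0 mulr_natr.
rewrite (split_sum gF F) (split_sum F gF) fsetIC.
have -> (a b c : R) : a + b - (a + c) = b - c by lra.
apply: le_trans (ler_normB _ _) _; apply: le_trans (lerD (bound _) (bound _)) _.
rewrite -mulrDr -natrD cardfsU.
suff -> : ((gF `\` F) `&` (F `\` gF))%fset = fset0 by rewrite cardfs0 subn0.
by apply/fsetP => x; rewrite !inE; case: (x \in F); rewrite ?andbF.
Qed.

(** Averages over Folner sets along the orbit of [x0]; the limit is taken along an ultrafilter so
    that it exists for every bounded function. *)
Lemma folner_full_mean (R : realType) (G : choiceType) (gG : grp G) (X : Type)
    (d : X -> X -> R) (act : G -> X -> X) (x0 : X) :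
  amenable R gG -> tds gG d act -> minimal d act ->
  exists L, full_mean d act L.
Proof.
move=> [F [F0 Ff]] Xt Xm; have [_ _ _ mul _] := Xt.
have [U [UU sub]] := ultraFilterLemma (eventually_filter : ProperFilter \oo).
have PU : ProperFilter U := ultra_proper.
have cF n : 0 < (#|` F n|%:R : R) by rewrite ltr0n cardfs_gt0.
pose avg (f : X -> R) n : R := (\sum_(g <- F n) f (act g x0)) / #|` F n|%:R.
have avg_bdd f : bdd f -> bdd (avg f).
  move=> [M fM]; exists M => n.
  rewrite normrM normfV (gtr0_norm (cF n)) ler_pdivrMr //.
  apply: le_trans (ler_norm_sum _ _ _) _.
  apply: le_trans (ler_sum _ (fun i _ => fM _)) _.
  by rewrite big_const_seq count_predT iter_addr_0 mulr_natr.
pose L f := lim (avg f @ U).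
have cvgL f : bdd f -> avg f @ U --> L f by move=> /avg_bdd; exact: ultra_cvg_bdd.
have limE f l : avg f @ U --> l -> L f = l by exact: (cvg_lim (@Rhausdorff R)).
have Lle f g : bdd f -> bdd g -> (forall z, f z <= g z) -> L f <= L g.
  move=> bf bg fg; apply: (ler_cvg_to (cvgL _ bf) (cvgL _ bg)).
  apply: nearW => n; rewrite ler_pM2r ?invr_gt0 //; exact: ler_sum.
have Ladd f g : bdd f -> bdd g -> L (fun z => f z + g z) = L f + L g.
  move=> bf bg; apply: limE.
  have -> : avg (fun z => f z + g z) = (avg f \+ avg g).
    by apply/funext => n; rewrite /avg big_split mulrDl.
  exact: cvgD (cvgL _ bf) (cvgL _ bg).
have Lscale c f : bdd f -> L (fun z => c * f z) = c * L f.
  move=> bf; apply: limE.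
  have -> : avg (fun z => c * f z) = (fun n => c * avg f n).
    by apply/funext => n; rewrite /avg -mulr_sumr mulrA.
  exact: cvgMl_tmp (cvgL _ bf).
have Lone : L (fun=> 1) = 1.
  apply: limE; have -> : avg (fun=> 1) = fun=> 1.
    apply/funext => n; rewrite /avg big_const_seq count_predT iter_addr_0 divff //.
    by rewrite gt_eqF.
  exact: cvg_cst.
have Lact h f : bdd f -> L (fun z => f (act h z)) = L f.
  move=> bf; have [M fM] := bf; apply: limE.
  pose diff n := avg (fun z => f (act h z)) n - avg f n.
  have -> : avg (fun z => f (act h z)) = avg f \+ diff.
    by apply/funext => n; rewrite /diff /= addrC subrK.
  rewrite -[L f]addr0; apply: cvgD (cvgL _ bf) _.
  suff diff0 : diff @ \oo --> 0 by apply: cvg_trans diff0; apply: cvg_app.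
  apply: norm_cvg0.
  apply: (@squeeze_cvgr _ _ _ _ (fun=> 0) (fun n => M * folner_ratio R gG h (F n))).
  - apply: nearW => n; rewrite normr_ge0 /= /diff /avg.
    have := folner_sum_le (f := fun g => f (act g x0)) gG h (F0 n) (fun g => fM _).
    by under eq_bigr do rewrite mul.
  - exact: cvg_cst.
  - rewrite -[X in _ --> X](mulr0 M); exact: cvgMl_tmp (Ff h).
exists L; split => //.
move=> O oO O0; have [s sP] := minimal_cover Xt Xm oO O0.
(* Positivity: this sum of translated indicators is at least 1 everywhere, and its mean is [size s]
   times that of [O]. *)
have Lsum : bdd (fun z => \sum_(g <- s) \1_O (act g z) : R) /\
    L (fun z => \sum_(g <- s) \1_O (act g z)) = (L \1_O) *+ size s.
  elim: (s) => [|g t [bt IH]].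
    under eq_fun do rewrite big_nil.
    split; first exact: bdd_cst.
    have -> : (fun=> 0) = (fun=> 0 * 1) :> (X -> R) by rewrite mulr1.
    by rewrite Lscale ?mul0r //; exact: bdd_cst.
  under eq_fun do rewrite big_cons.
  have b1 : bdd (fun z => \1_O (act g z) : R) by apply: bdd_comp; exact: bdd_indic.
  split; first exact: bddD.
  by rewrite Ladd // IH Lact ?mulrS //; exact: bdd_indic.
rewrite ltNge; apply/negP => neg.
suff : (1 : R) <= 0 by rewrite ler10.
rewrite -[leLHS]Lone; apply: le_trans (_ : (L \1_O) *+ size s <= 0); last exact: mulrn_wle0.
rewrite -Lsum.2; apply: Lle => [||z]; [exact: bdd_cst|exact: Lsum.1|].
have [g gs Og] := sP z; rewrite (big_rem g) //= indicE mem_set // lerDl.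
by apply: sumr_ge0 => k _; rewrite indicE ler0n.
Qed.

(** * Limits of fibers *)

(** The suprema in [hausdorff_dist] are genuine only on sets bounded above; otherwise [sup] takes a
    default value. *)
Lemma mcompact_bounded (R : realType) (X : Type) (d : X -> X -> R) (x : X) :
  is_metric d -> mcompact d -> exists M, forall y, d x y <= M.
Proof.
move=> mX cX; pose P S := exists M, forall y, S y -> d x y <= M.
suff [M MP] : P setT by exists M => y; exact: MP.
apply: (mcompact_ind cX).
- by exists 0.
- move=> A B [M MP] [N NP]; exists (Num.max M N) => y [/MP|/NP] h; rewrite le_max h //.
  by rewrite orbT.
- by move=> A B AB [M MP]; exists M => y /AB /MP.
move=> y; exists [set z | d y z < 1].
  by split; [exact: mopen_ball|rewrite /= dist_refl].
have [_ _ _ tri] := mX.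
by exists (d x y + 1) => z /= yz; have := tri x y z; lra.
Qed.

Lemma hausdorff_distC (R : realType) (X : Type) (d : X -> X -> R) (A B : set X) :
  is_metric d -> hausdorff_dist d A B = hausdorff_dist d B A.
Proof.
move=> [_ _ sym _]; rewrite /hausdorff_dist maxC; congr Num.max; congr sup;
by apply: eq_imagel => x _; congr inf; apply: eq_imagel => y _; exact: sym.
Qed.

(** The strict bound avoids asking whether the infimum is attained, and nonemptiness of [B] avoids
    its default value. *)
Lemma hausdorff_dist_lt (R : realType) (X : Type) (d : X -> X -> R)
    (A B : set X) (t : R) (a : X) :
  is_metric d -> mcompact d -> B !=set0 -> hausdorff_dist d A B < t -> A a ->
  exists2 b, B b & d a b < t.
Proof.
move=> mX cX [b0 Bb0]; rewrite /hausdorff_dist gt_max => /andP[lt _] Aa.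
have [d0 _ sym tri] := mX.
apply: contrapT => nb; move: lt; apply/negP; rewrite -leNgt.
have [M MP] := mcompact_bounded b0 mX cX.
apply: (@le_trans _ _ (inf [set d a b | b in B])).
  apply: lb_le_inf; first by exists (d a b0), b0.
  by move=> _ [b Bb <-]; rewrite leNgt; apply/negP => lt; apply: nb; exists b.
apply: ub_le_sup; last by exists a.
exists M => _ [a' _ <-]; apply: le_trans (MP a'); rewrite sym; apply: ge_inf.
  by exists 0 => _ [b _ <-].
by exists b0.
Qed.

Lemma hausdorff_dist_le (R : realType) (X : Type) (d : X -> X -> R)
    (A B : set X) (t : R) :
  is_metric d -> A !=set0 -> B !=set0 ->
  (forall a, A a -> exists2 b, B b & d a b <= t) ->
  (forall b, B b -> exists2 a, A a & d a b <= t) -> hausdorff_dist d A B <= t.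
Proof.
move=> [d0 _ sym tri] [a0 Aa0] [b0 Bb0] AB BA.
rewrite /hausdorff_dist ge_max; apply/andP; split; apply: ge_sup.
- by exists (inf [set d a0 b | b in B]), a0.
- move=> _ [a /AB [b Bb ab] <-]; apply: le_trans ab; apply: ge_inf; last by exists b.
  by exists 0 => _ [c _ <-].
- by exists (inf [set d a b0 | a in A]), b0.
- move=> _ [b /BA [a Aa ab] <-]; apply: le_trans ab; apply: ge_inf; last by exists a.
  by exists 0 => _ [c _ <-].
Qed.

Lemma hausdorff_dist_tri (R : realType) (X : Type) (d : X -> X -> R)
    (A B C : set X) (s t : R) :
  is_metric d -> mcompact d -> A !=set0 -> B !=set0 -> C !=set0 ->
  hausdorff_dist d A B < s -> hausdorff_dist d B C < t ->
  hausdorff_dist d A C <= s + t.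
Proof.
move=> mX cX A0 B0 C0 AB BC; have [_ _ sym tri] := mX.
apply: (hausdorff_dist_le mX A0 C0) => x.
- move=> /(hausdorff_dist_lt mX cX B0 AB) [b Bb ab].
  have [c Cc bc] := hausdorff_dist_lt mX cX C0 BC Bb.
  by exists c => //; have := tri x b c; lra.
- rewrite hausdorff_distC // in AB; rewrite hausdorff_distC // in BC.
  move=> /(hausdorff_dist_lt mX cX B0 BC) [b Bb ab].
  have [c Cc bc] := hausdorff_dist_lt mX cX A0 AB Bb.
  by exists c => //; have := tri c b x; rewrite (sym c b) (sym b x); lra.
Qed.

(* Compactness of the hyperspace, in the form of limits along ultrafilters. *)
Lemma ultra_hausdorff_limit (R : realType) (X I : Type) (d : X -> X -> R)
    (C : I -> set X) (U : set_system I) :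
  is_metric d -> mcompact d -> (forall i, C i !=set0) -> UltraFilter U ->
  exists F, hyperspace d F /\
    forall r, 0 < r -> U [set i | hausdorff_dist d F (C i) < r].
Proof.
move=> mX cX C0 UU; have PU : ProperFilter U := ultra_proper.
have [_ _ sym tri] := mX.
pose meets x r := [set i | exists2 c, C i c & d x c < r].
pose F := [set x | forall r, 0 < r -> U (meets x r)].
have nF x : ~ F x -> exists2 r, 0 < r & U (~` meets x r).
  move=> /existsNP [r /not_implyP [r0 nU]]; exists r => //.
  by have [] := in_ultra_setVsetC (meets x r) UU.
have cF : mclosed d F.
  move=> x /nF [r r0 rP]; have r20 : 0 < r / 2 by rewrite divr_gt0.
  exists (r / 2) => // y xy Fy.
  have [i [mi [c Cc yc]]] := filter_ex (filterI rP (Fy _ r20)).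
  by apply: mi; exists c => //; have := tri x y c; lra.
(* [near1] and [near2] are the two halves of convergence. Around a point outside [F], some ball
   misses almost every [C i]. *)
have near1 r : 0 < r -> U [set i | forall c, C i c -> exists2 x, F x & d x c < r].
  move=> r0; pose P S := U [set i | forall c, C i c -> S c -> exists2 x, F x & d x c < r].
  suff : P setT by rewrite /P; apply: filterS => i h c Cc; exact: h.
  apply: (mcompact_ind cX).
  - by rewrite /P; apply: filterS filterT => i _ c.
  - move=> A B; rewrite /P => PA PB; apply: filterS (filterI PA PB) => i [hA hB] c Cc [Ac|Bc].
      exact: hA.
    exact: hB.
  - by move=> A B AB; rewrite /P; apply: filterS => i h c Cc /AB; exact: h.
  move=> x; have [Fx|/nF [s s0 sP]] := pselect (F x).
    exists [set y | d x y < r].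
      by split; [exact: mopen_ball|rewrite /= dist_refl].
    by rewrite /P; apply: filterS filterT => i _ c _ xc; exists x.
  exists [set y | d x y < s].
    by split; [exact: mopen_ball|rewrite /= dist_refl].
  by rewrite /P; apply: filterS sP => i nm c Cc xc; exfalso; apply: nm; exists c.
have near2 r : 0 < r -> U [set i | forall x, F x -> exists2 c, C i c & d x c < r].
  move=> r0; pose P S := U [set i | forall x, F x -> S x -> exists2 c, C i c & d x c < r].
  suff : P setT by rewrite /P; apply: filterS => i h x Fx; exact: h.
  apply: (mcompact_ind cX).
  - by rewrite /P; apply: filterS filterT => i _ c.
  - move=> A B; rewrite /P => PA PB; apply: filterS (filterI PA PB) => i [hA hB] c Cc [Ac|Bc].
      exact: hA.
    exact: hB.
  - by move=> A B AB; rewrite /P; apply: filterS => i h c Cc /AB; exact: h.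
  have r20 : 0 < r / 2 by rewrite divr_gt0.
  move=> x; have [Fx|nFx] := pselect (F x); last first.
    exists (~` F) => //.
    by rewrite /P; apply: filterS filterT => i _ c.
  exists [set y | d x y < r / 2].
    by split; [exact: mopen_ball|rewrite /= dist_refl].
  rewrite /P; apply: filterS (Fx _ r20) => i [c Cc xc] y _ /= xy; exists c => //.
  by have := tri y x c; rewrite (sym y x); lra.
have F0 : F !=set0.
  have [i /= h] := filter_ex (near1 1 ltr01); have [c /h [x Fx _]] := C0 i.
  by exists x.
exists F; split=> [//|r r0].
have r20 : 0 < r / 2 by rewrite divr_gt0.
apply: filterS (filterI (near1 _ r20) (near2 _ r20)) => i [h1 h2].
apply: (@le_lt_trans _ _ (r / 2)); last by lra.
apply: hausdorff_dist_le => // x.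
- by move=> /h2 [c Cc xc]; exists c => //; exact: ltW.
- by move=> /h1 [c Cc xc]; exists c => //; exact: ltW.
Qed.

(** Two points of [F] are close to points of one common fiber, so continuity identifies their
    images. Hence each member of [calX] lies over a single point. *)
Lemma calX_fiber (R : realType) (X Y : Type) (d : X -> X -> R)
    (dY : Y -> Y -> R) (pi : X -> Y) (F : set X) (x y : X) :
  is_metric d -> mcompact d -> is_metric dY -> mcontinuous d dY pi ->
  (forall y, exists x, pi x = y) -> calX d pi F -> F x -> F y -> pi x = pi y.
Proof.
move=> mX cX mY cpi spi [[F0 _] lim] Fx Fy; have [Y0 Ye Ysym Ytri] := mY.
apply/Ye/eqP; rewrite eq_le Y0 andbT leNgt; apply/negP => pos.
have pos2 : 0 < dY (pi x) (pi y) / 2 by rewrite divr_gt0.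
have [r r0 rP] := cpi x _ pos2; have [s s0 sP] := cpi y _ pos2.
have [|z ltz] := lim (Num.min r s); first by rewrite lt_min r0.
have f0 : (pi @^-1` [set z]) !=set0 by have [w wz] := spi z; exists w.
have [a az] := hausdorff_dist_lt mX cX f0 ltz Fx.
have [b bz] := hausdorff_dist_lt mX cX f0 ltz Fy.
rewrite !lt_min => /andP[_ /sP hb] /andP[/rP ha _].
rewrite /= in az bz; rewrite az in ha; rewrite bz in hb.
by have := Ytri (pi x) z (pi y); rewrite (Ysym z); lra.
Qed.

Lemma mclosed_adherent (R : realType) (Y : Type) (dY : Y -> Y -> R) (S : set Y) :
  is_metric dY ->
  mclosed dY [set y | forall r, 0 < r -> exists2 y', S y' & dY y y' < r].
Proof.
move=> [_ _ _ tri] y /existsNP [r /not_implyP [r0 nS]].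
exists (r / 2) => [|z yz adh]; first by rewrite divr_gt0.
have [|y' Sy' zy'] := adh (r / 2); first by rewrite divr_gt0.
by apply: nS; exists y' => //; have := tri y z y'; lra.
Qed.

(** The traces on [S] of the balls around [y] generate a proper filter. The ultrafilter serves to
    take limits of fibers over points tending to [y]. *)
Lemma adherent_ultra (R : realType) (Y : Type) (dY : Y -> Y -> R) (S : set Y) (y : Y) :
  (forall r, 0 < r -> exists2 y', S y' & dY y y' < r) ->
  exists U : set_system Y, [/\ UltraFilter U, U S &
    forall r, 0 < r -> U [set y' | dY y y' < r]].
Proof.
move=> adh.
pose B : set_system Y := [set A | exists2 r, 0 < r &
  forall y', S y' -> dY y y' < r -> A y'].
have PB : ProperFilter B.
  split.
    by move=> [r r0 rP]; have [y' Sy' yy'] := adh r r0; exact: rP yy'.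
  split.
  - by exists 1.
  - move=> P Q [r r0 rP] [s s0 sQ]; exists (Num.min r s); first by rewrite lt_min r0.
    by move=> y' Sy'; rewrite lt_min => /andP[? ?]; split; [exact: rP|exact: sQ].
  - by move=> P Q PQ [r r0 rP]; exists r => // y' Sy' /rP h; apply: PQ; exact: h.
have [U [UU sub]] := ultraFilterLemma PB.
by exists U; split => // [|r r0]; apply: sub; [exists 1|exists r].
Qed.

(* Exhibits the image of an open ball as a countable union of closed sets. *)
Lemma pi_calX_ballE (R : realType) (X Y : Type) (d : X -> X -> R)
    (dY : Y -> Y -> R) (pi : X -> Y) (E : set X) (e : R) :
  is_metric d -> mcompact d -> is_metric dY -> mcontinuous d dY pi ->
  (forall y, exists x, pi x = y) -> E !=set0 ->
  pi_calX pi (calX_ball d pi E e) =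
  \bigcup_m [set y | forall r, 0 < r -> exists2 y',
    hausdorff_dist d (pi @^-1` [set y']) E <= e - m.+1%:R^-1 & dY y y' < r].
Proof.
move=> mX cX mY cpi spi E0; have [Y0 Ye Ysym Ytri] := mY.
have f0 z : (pi @^-1` [set z]) !=set0 by have [w wz] := spi z; exists w.
apply/seteqP; split=> [y [F [[[F0 _] lim] FE] [x Fx xy]]|y [m _ adh]].
  (* One third of the gap goes to the distance from [F] to a nearby fiber, one to the strict bound
     in the triangle inequality, and one dominates 1/(m+1). *)
  pose eta := (e - hausdorff_dist d F E) / 3.
  have eta0 : 0 < eta by rewrite divr_gt0 // subr_gt0.
  exists (Num.truncn eta^-1) => // r r0.
  have small : ((Num.truncn eta^-1).+1%:R)^-1 <= eta.
    rewrite invf_ple ?posrE ?ltr0n //.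
    by apply: ltW; rewrite truncnS_gt.
  have [s s0 sP] := cpi x r r0.
  have [|z ltz] := lim (Num.min eta s); first by rewrite lt_min eta0.
  exists z; last first.
    have [w <-] := hausdorff_dist_lt mX cX (f0 z) ltz Fx.
    by rewrite lt_min -xy => /andP[_ /sP].
  rewrite hausdorff_distC // lt_min in ltz; have /andP[ltz1 _] := ltz.
  have := hausdorff_dist_tri mX cX (f0 z) F0 E0 ltz1 (t := hausdorff_dist d F E + eta).
  rewrite ltrDl => /(_ eta0) tri; apply: le_trans tri _; rewrite lerBrDl.
  by apply: le_trans (lerD small (lexx _)) _; rewrite /eta; lra.
(* Conversely, a limit of fibers over points tending to [y] lies over [y], and the slack 1/(m+1)
   keeps it in the open ball. *)
have [U [UU US Unear]] := adherent_ultra adh.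
have PU : ProperFilter U := ultra_proper.
have [F [hF limF]] := ultra_hausdorff_limit mX cX f0 UU; have [F0 _] := hF.
have m0 : 0 < (m.+1%:R^-1 : R) by rewrite invr_gt0 ltr0n.
exists F; first split.
- split => // t t0; have [z] := filter_ex (limF t t0); by exists z.
(* [k] is spent twice, which leaves half of the slack. *)
- pose k : R := m.+1%:R^-1 / 4; have k0 : 0 < k by rewrite divr_gt0.
  have [z [/= Fz zE]] := filter_ex (filterI (limF k k0) US).
  have := hausdorff_dist_tri mX cX F0 (f0 z) E0 Fz (t := e - m.+1%:R^-1 + k).
  by rewrite /k in zE *; move: m0 zE; set q := m.+1%:R^-1 => m0 zE h; lra.
- have [x Fx] := F0; exists x => //; apply/Ye/eqP; rewrite eq_le Y0 andbT leNgt.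
  apply/negP => pos; have pos2 : 0 < dY (pi x) y / 2 by rewrite divr_gt0.
  have [s s0 sP] := cpi x _ pos2.
  have [z [/= Fz zy]] := filter_ex (filterI (limF s s0) (Unear _ pos2)).
  have [w wz /sP] := hausdorff_dist_lt mX cX (f0 z) Fz Fx.
  by rewrite wz; have := Ytri (pi x) z y; rewrite (Ysym z); lra.
Qed.

Lemma pi_calX_ball_measurable (R : realType) (X : Type) (dsp : measure_display)
    (Y : measurableType dsp) (d : X -> X -> R) (dY : Y -> Y -> R) (pi : X -> Y)
    (E : set X) (e : R) :
  is_metric d -> mcompact d -> is_metric dY -> mcontinuous d dY pi ->
  (forall y, exists x, pi x = y) -> E !=set0 ->
  (measurable : set (set Y)) = borel_sets dY ->
  measurable (pi_calX pi (calX_ball d pi E e)).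
Proof.
move=> mX cX mY cpi spi E0 bor; rewrite (pi_calX_ballE e mX cX mY cpi spi E0).
apply: bigcupT_measurable => m; rewrite -[X in measurable X]setCK.
apply: measurableC; rewrite bor; apply: sub_sigma_algebra.
exact: mclosed_adherent.
Qed.

(** * Densities *)

Lemma borel_preimage (R : realType) (dsp : measure_display)
    (Y : measurableType dsp) (dY : Y -> Y -> R) (f : Y -> Y) (A : set Y) :
  (measurable : set (set Y)) = borel_sets dY -> mcontinuous dY dY f ->
  measurable A -> measurable (f @^-1` A).
Proof.
move=> bor cf.
suff sub : borel_sets dY `<=` [set B | measurable (f @^-1` B)].
  by rewrite {1}bor => /sub.
apply: smallest_sub.
- split=> [|B mB|B mB] /=.
  + by rewrite preimage_set0.
  + by rewrite setTD -preimage_setC; exact: measurableC.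
  + by rewrite preimage_bigcup; exact: bigcupT_measurable.
- move=> B oB /=; rewrite bor; apply: sub_sigma_algebra.
  exact: mopen_preimage cf oB.
Qed.

(** The integral over [y] of the proportion of visits is [a], so this proportion cannot stay at or
    below [t] everywhere. *)
Lemma exists_many_visits (R : realType) (G : choiceType) (dsp : measure_display)
    (Y : measurableType dsp) (actY : G -> Y -> Y) (nu : probability Y R)
    (A : set Y) (F : {fset G}) (a t : R) :
  (forall g, measurable (actY g @^-1` A)) ->
  (forall g, nu (actY g @^-1` A) = a%:E) -> F != fset0 -> t < a ->
  exists y, t < #|` [fset g in F | actY g y \in A]%fset|%:R / #|` F|%:R.
Proof.
move=> mA iA F0 ta; apply: contrapT => nex.
have cF : 0 < (#|` F|%:R : R) by rewrite ltr0n cardfs_gt0.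
pose f g y := (\1_(actY g @^-1` A) y : R)%:E.
have mf g : measurable_fun setT (f g).
  by apply/measurable_EFinP; exact: measurable_indic.
have f0 g y : setT y -> (0 <= f g y)%E by rewrite lee_fin indicE ler0n.
have intf g : (\int[nu]_y f g y)%E = a%:E.
  by rewrite /f integral_indic // setIT; exact: iA.
have le_t y : (\sum_(g <- F) f g y <= (t * #|` F|%:R)%:E)%E.
  rewrite /f sumEFin lee_fin -ler_pdivrMr // leNgt; apply/negP => lt.
  apply: nex; exists y; congr (_ < _ / _): lt.
  under eq_bigr do rewrite indicE mulrb.
  rewrite -big_mkcond big_fset_condE big_const_seq count_predT iter_addr_0 /=.
  by congr (#|` _|%:R); apply/fsetP => g; rewrite !inE /=; congr (_ && _);
    apply/idP/idP; rewrite !inE.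
have : (\int[nu]_y (\sum_(g <- F) f g y) <= \int[nu]_y (cst (t * #|` F|%:R)%:E y))%E.
  apply: ge0_le_integral => //.
  - by move=> y _; apply: sume_ge0 => g _; exact: f0.
  - exact: emeasurable_sum.
rewrite integral_cst // [X in (_ * X)%E](probability_setT nu) mule1 ge0_integral_sum //.
under eq_bigr do rewrite intf.
rewrite sumEFin lee_fin big_const_seq count_predT iter_addr_0 -(mulr_natr a).
by rewrite ler_pM2r // leNgt ta.
Qed.

Definition rtranslate (G : choiceType) (gG : grp G) (k : G) (F : {fset G}) : {fset G} :=
  [fset gmul gG x k | x in F]%fset.

Lemma mem_rtranslate (G : choiceType) (gG : grp G) (k : G) (F : {fset G}) (x : G) :
  (x \in rtranslate gG k F) = (gmul gG x (ginv gG k) \in F).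
Proof.
rewrite -{1}[x](gmulr1 gG) -(gmulV gG k) gmulA.
by rewrite (mem_imfset _ _ (@gmulr_inj _ gG k)).
Qed.

Lemma mem_ltranslate (G : choiceType) (gG : grp G) (k : G) (F : {fset G}) (x : G) :
  (x \in ltranslate gG k F) = (gmul gG (ginv gG k) x \in F).
Proof.
rewrite -{1}[x](gmul1 gG) -(gmulVr gG k) -gmulA.
by rewrite (mem_imfset _ _ (@gmull_inj _ gG k)).
Qed.

Lemma card_rtranslate (G : choiceType) (gG : grp G) (k : G) (F : {fset G}) :
  #|` rtranslate gG k F| = #|` F|.
Proof. by rewrite card_imfset //; exact: gmulr_inj. Qed.

(** Right translations commute with the left ones in the ratio and preserve cardinality, so the
    translating element may vary with [n]. *)
Lemma folner_rtranslate (R : realType) (G : choiceType) (gG : grp G)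
    (F : nat -> {fset G}) (k : nat -> G) :
  folner R gG F -> folner R gG (fun n => rtranslate gG (k n) (F n)).
Proof.
move=> [F0 Ff]; split=> [n|g].
  by rewrite -cardfs_gt0 card_rtranslate cardfs_gt0.
rewrite (_ : (fun n => _) = (fun n => folner_ratio R gG g (F n))) //.
apply/funext => n; rewrite /folner_ratio card_rtranslate; congr (_%:R / _).
rewrite -[RHS](card_rtranslate gG (k n)); congr (#|` _|); apply/fsetP => x.
rewrite [RHS]mem_rtranslate !in_fsetU !in_fsetD !mem_ltranslate !mem_rtranslate.
by rewrite gmulA.
Qed.

Lemma density_along_ge0 (R : realType) (G : choiceType) (F : nat -> {fset G})
    (S : set G) (n : nat) : 0 <= density_along R F S n.
Proof. by rewrite divr_ge0. Qed.

Lemma density_along_le1 (R : realType) (G : choiceType) (F : nat -> {fset G})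
    (S : set G) (n : nat) : F n != fset0 -> density_along R F S n <= 1.
Proof.
move=> F0; rewrite ler_pdivrMr ?ltr0n ?cardfs_gt0 // mul1r ler_nat.
have fin : finite_set ([set` F n] `&` S) by apply: finite_setIl; exact: finite_fset.
by apply: fsubset_leq_card; apply/fsubsetP => x; rewrite in_fset_set // inE => -[].
Qed.

Lemma bounded_density (R : realType) (G : choiceType) (F : nat -> {fset G})
    (S : set G) : (forall n, F n != fset0) ->
  bounded_fun (density_along R F S : (R^o)^nat).
Proof.
move=> F0; exists 1; split => // M M1 n _ /=.
rewrite ger0_norm ?density_along_ge0 //.
exact: le_trans (density_along_le1 _ _ (F0 n)) (ltW M1).
Qed.

Lemma sups_density_le1 (R : realType) (G : choiceType) (F : nat -> {fset G})
    (S : set G) (n : nat) : (forall n, F n != fset0) ->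
  sups (density_along R F S) n <= 1.
Proof.
move=> F0; apply: ge_sup; first by exists (density_along R F S n), n => /=.
by move=> _ [m _ <-]; exact: density_along_le1.
Qed.

Lemma density_le_sups (R : realType) (G : choiceType) (F : nat -> {fset G})
    (S : set G) (n : nat) : (forall n, F n != fset0) ->
  density_along R F S n <= sups (density_along R F S) n.
Proof.
move=> F0; apply: ub_le_sup; last by exists n => /=.
by exists 1 => _ [m _ <-]; exact: density_along_le1.
Qed.

(** A bound uniform over Folner sequences makes the supremum in [upper_banach_density] genuine. *)
Lemma limn_sup_density_le1 (R : realType) (G : choiceType) (F : nat -> {fset G})
    (S : set G) : (forall n, F n != fset0) -> limn_sup (density_along R F S) <= 1.
Proof.
move=> F0; rewrite limn_supE; last exact: bounded_density.
apply: le_trans (sups_density_le1 R S 0 F0); apply: ge_inf; last by exists 0%N.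
exists 0 => _ [n _ <-]; exact: le_trans (density_along_ge0 _ _ _ _) (density_le_sups _ _ _ F0).
Qed.

Lemma upper_banach_density_ge (R : realType) (G : choiceType) (gG : grp G)
    (F : nat -> {fset G}) (S : set G) (t : R) :
  folner R gG F -> (forall n, t <= density_along R F S n) ->
  t <= upper_banach_density R gG S.
Proof.
move=> Ff tS; have [F0 _] := Ff.
apply: (@le_trans _ _ (limn_sup (density_along R F S))).
  rewrite limn_supE; last exact: bounded_density.
  apply: lb_le_inf; first by exists (sups (density_along R F S) 0), 0%N.
  move=> _ [n _ <-]; exact: le_trans (tS n) (density_le_sups _ _ _ F0).
apply: ub_le_sup; last by exists F.
by exists 1 => _ [F' [F'0 _] <-]; exact: limn_sup_density_le1.
Qed.

(** * Positive density of joint return times *)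

Theorem theorem5p1
  (R : realType)
  (G : countType) (gG : grp G) (G_infinite : infinite_set [set: G])
  (G_amenable : amenable R gG)
  (X : Type) (d : X -> X -> R) (act : G -> X -> X)
  (X_tds : tds gG d act) (X_minimal : minimal d act)
  (X_LB : local_Bronstein d act)
  (dsp : measure_display) (Xeq : measurableType dsp)
  (deq : Xeq -> Xeq -> R) (acteq : G -> Xeq -> Xeq)
  (Xeq_borel : measurable = borel_sets deq)
  (pieq : X -> Xeq)
  (pieq_max : max_equicontinuous_factor gG d act deq acteq pieq)
  (nueq : probability Xeq R)
  (nueq_inv : forall g (A : set Xeq), measurable A -> nueq (acteq g @^-1` A) = nueq A) :
  forall E, calX_meas d pieq nueq E -> wms_set gG d act E.
Proof.
move=> E [EX Epos] K x Ex U UP.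
have [mX cX _ mul cont] := X_tds.
have [Yt _ [cpi spi epi] _] := pieq_max.
have [mY _ _ _ contY] := Yt.
have [[E0 _] _] := EX.
have [e e0 eU] : exists2 e : R, 0 < e & forall k y, d y (x k) < e -> U k y.
  have rad k : exists r : R, 0 < r /\ forall y, d (x k) y < r -> U k y.
    by have [oU Ux] := UP k; have [r r0 rP] := oU _ Ux; exists r.
  have [r rP] := choice rad.
  (* The default 1 keeps the radius positive when [K] is 0. *)
  exists (\big[Num.min/1]_k r k); first by apply: lt_bigmin => // k _; exact: (rP k).1.
  have [_ _ sym _] := mX => k y; rewrite sym => lt; apply: (rP k).2.
  by apply: lt_le_trans lt _; exact: bigmin_le.
set A := pi_calX pieq (calX_ball d pieq E e).
have mA : measurable A by exact: (pi_calX_ball_measurable e mX cX mY cpi spi E0 Xeq_borel).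
have AU y k : A y -> exists2 z, U k z & pieq z = y.
  move=> [F [FX FE] [z Fz zy]]; rewrite hausdorff_distC // in FE.
  have [[F0 _] _] := FX.
  have [w Fw xw] := hausdorff_dist_lt mX cX F0 FE (Ex k).
  exists w; first by apply: eU; have [_ _ sym _] := mX; rewrite sym.
  by rewrite -zy; exact: (calX_fiber mX cX mY cpi spi FX).
have nAE : nueq A = (fine (nueq A))%:E by rewrite fineK // fin_num_measure.
set a := fine (nueq A) in nAE.
have a0 : 0 < a by rewrite -lte_fin -nAE; exact: Epos.
have [x0 _] := E0.
have [L ML] := folner_full_mean x0 G_amenable X_tds X_minimal.
have [F Ff] := G_amenable; have [F0 _] := Ff.
(* [a] does not depend on [V]. Averaging gives any proportion below [a], here a/2, and a/4 makes the
   final inequality strict. *)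
exists (a / 4); first by rewrite divr_gt0.
move=> V oV V0; set S := [set g | _].
have step n : exists k, a / 2 <= #|` fset_set ([set` rtranslate gG k (F n)] `&` S)|%:R
    / #|` rtranslate gG k (F n)|%:R.
  have [|||y ylt] := exists_many_visits (actY := acteq) (nu := nueq) (A := A) (a := a)
      (t := a / 2) _ _ (F0 n) _.
  - by move=> g; exact: borel_preimage Xeq_borel (contY g) mA.
  - by move=> g; rewrite nueq_inv.
  - by lra.
  (* At each time [f] in [F'] the point fy lies in [A], so the fiber of [y] meets f^-1 U_k for all
     [k]. *)
  set F' := [fset _ in _ | _]%fset in ylt.
  have [_ /allpairsP [[f k] [/= fF _ ->]]|g gP] :=
    fiber_visit (y := y) (Us := [seq act f @^-1` U k | f <- F', k <- enum 'I_K])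
      X_tds X_minimal pieq_max ML oV V0.
    have [oU _] := UP k; split; first exact: mopen_preimage (cont f) oU.
    move: fF; rewrite !inE => /andP[_ /set_mem fA].
    have [z Uz zy] := AU _ k fA; exists (act (ginv gG f) z); split => /=.
      by rewrite (actVK f X_tds).
    by rewrite epi zy (actK f Yt).
  exists g; rewrite card_rtranslate; apply: ltW; apply: lt_le_trans ylt _.
  rewrite ler_pM2r ?invr_gt0 ?ltr0n ?cardfs_gt0 // ler_nat.
  (* For [f] in [F'] the product fg is a return time: gV meets f^-1 U_k, so fgV meets U_k. *)
  rewrite -(card_rtranslate gG g F'); apply: fsubset_leq_card.
  have fin : finite_set ([set` rtranslate gG g (F n)] `&` S).
    by apply: finite_setIl; exact: finite_fset.
  apply/fsubsetP => h /imfsetP [f /= fF' ->]; rewrite in_fset_set // inE; split.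
    by apply/imfsetP; exists f => //; move: fF'; rewrite !inE => /andP[].
  move=> k; have [|z [[v Vv vz] Uz]] := gP (act f @^-1` U k).
    by apply/allpairsP; exists (f, k); split => //=; rewrite mem_enum.
  by exists (act f z); split => //; exists v => //; rewrite mul vz.
have [k kP] := choice step.
apply: (@lt_le_trans _ _ (a / 2)); first by lra.
exact: (upper_banach_density_ge (folner_rtranslate k Ff)).
Qed.
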